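(* (Schur relations) Suppose given $i,i'\in[1,k]$, $a,b\in[1,x_i]$, $a',b'\in[1,x_{i'}]$. Then $$\frac{g}{x_id_i}\cdot\delta_{(i;a,b),(i';a',b')}\;=\;\sum_{l\in[1,h],\ \sigma\in G}(\sigma y_l)\omega_{i;a,b}\cdot\operatorname{tr}_{K_{i'}/K}\Big((y_l^\ast\sigma^{-1})\omega_{i';b',a'}\Big).$$
   Context: A finite group $G$ acts (from the right, $y\mapsto y^\sigma$, by field automorphisms, not necessarily faithfully) on a field $L$ with fixed field $K$. Let $N$ be the kernel of this operation, $g=|G|$, $h=[L:K]$, $n=|N|$, so $g=hn$. Assume that $n$ is invertible in $K$. Let $(y_l)_{l\in[1,h]}$ be a $K$-basis of $L$ and $(y_l^\ast)_{l\in[1,h]}$ its dual basis with respect to the trace, $\operatorname{Tr}_{L/K}(y_ly_m^\ast)=\delta_{l,m}$. The twisted group ring $L\wr G$ is the $K$-algebra which as a right $L$-vector space has basis $G$, with multiplication determined by $(\sigma y)(\tau z)=(\sigma\tau)(y^\tau z)$. It is semisimple. Let $X_1,\dots,X_k$ be representatives of the isomorphism classes of simple right $L\wr G$-modules, $K_i=\operatorname{End}_{L\wr G}X_i$ (a skew field, acting on $X_i$ from the left), $x_i$ the left $K_i$-dimension of $X_i$, $d_i^2=[K_i:Z(K_i)]$ with $d_i\ge1$. It is known that $x_id_i/h$ is an integer that is invertible in $K$; $\frac{g}{x_id_i}$ denotes the element $n\cdot\left(\frac{x_id_i}{h}\right)^{-1}$ of $K$. With respect to a chosen $K_i$-basis,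 $X_i$ is viewed as rows over $K_i$ and $\operatorname{End}_{K_i}X_i$ as the ring of $x_i\times x_i$-matrices over $K_i$ acting from the right; the operation of $\xi\in L\wr G$ on $X_i$ is written as the matrix $((\xi)\omega_{i;a,b})_{a,b\in[1,x_i]}$ with entries in $K_i$. Moreover $\operatorname{tr}_{K_i/K}=\operatorname{Tr}_{Z(K_i)/K}\circ\operatorname{tr}_{K_i/Z(K_i)}$, where $\operatorname{tr}_{K_i/Z(K_i)}$ is the reduced trace. $\delta$ is the Kronecker delta. *)

(* Defs.v *)
From HB Require Import structures.
From mathcomp Require Import all_boot all_algebra all_fingroup all_field.

Set Implicit Arguments.
Unset Strict Implicit.
Unset Printing Implicit Defensive.

Import GRing.Theory passmx.
Local Open Scope ring_scope.

(* The trace of left multiplication by a on A; for a finite field extension   *)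
(* L of K this is Tr_{L/K}.                                                   *)
Definition alg_trace (K : fieldType) (A : falgType K) (a : A) : K :=
  \tr (mxof (vbasis {:A}) (vbasis {:A}) (amull a)).

Section TwistedGroupRing.

Variables (K : fieldType) (L : fieldExtType K) (gT : finGroupType).

(* K is identified with its image 1%VS in L.                                  *)
Record field_action := FieldAction {
  fact :> {action gT &-> L};
  factD : forall s, {morph fact^~ s : y z / y + z};
  factM : forall s, {morph fact^~ s : y z / y * z};
  fact1 : forall s, fact 1 s = 1;
  fact_fixed : forall y, (forall s, fact y s = y) <-> y \in 1%VS
}.

Variable to : field_action.

Lemma factA y s t : to y (s * t)%g = to (to y s) t.
Proof. by case: (fact to) => a [_ aM] /=; rewrite aM ?inE. Qed.

Lemma fact_id y : to y 1%g = y.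
Proof.
case: (fact to) => a [a_inj aM] /=; apply: (a_inj 1%g).
by rewrite -aM ?inE ?mulg1.
Qed.

Lemma fact0 s : to 0 s = 0.
Proof. by apply: (addIr (to 0 s)); rewrite -factD !add0r. Qed.

Lemma factZ s (k : K) y : to (k *: y) s = k *: to y s.
Proof.
have /(fact_fixed to)/(_ s) kP : k%:A \in (1%VS : {vspace L}).
  by rewrite memvZ ?memv_line.
by rewrite -mulr_algl factM kP mulr_algl.
Qed.

Lemma fact_sum s (I : finType) (F : I -> L) :
  to (\sum_i F i) s = \sum_i to (F i) s.
Proof. exact: (big_morph _ (factD to s) (fact0 s)). Qed.

(* The function f stands for the sum of the s (f s), with the coefficients on *)
(* the right of the group elements.                                           *)
Definition twring (_ : field_action) : Type := {ffun gT -> L}.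
Local Notation LG := (twring to).

HB.instance Definition _ := Vector.on LG.

Implicit Types f g : LG.

Definition tw (s : gT) (y : L) : LG := [ffun r => if r == s then y else 0].

Definition tw_one : LG := tw 1%g 1.

Definition tw_mul f g : LG :=
  [ffun r => \sum_s to (f s) (s^-1 * r)%g * g (s^-1 * r)%g].

Lemma tw_mulA : associative tw_mul.
Proof.
move=> f g u; apply/ffunP=> r; rewrite !ffunE.
under eq_bigr => s _ do rewrite ffunE mulr_sumr.
under [RHS]eq_bigr => t _ do rewrite ffunE fact_sum mulr_suml.
rewrite [RHS]exchange_big /=; apply: eq_bigr => s _.
rewrite [RHS](reindex_inj (mulgI s)) /=; apply: eq_bigr => t _.
by rewrite mulKg factM -factA invMg -!mulgA mulKVg mulrA.
Qed.

Lemma tw_mul1l : left_id tw_one tw_mul.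
Proof.
move=> f; apply/ffunP=> r; rewrite ffunE (bigD1 1%g) //= ffunE eqxx.
rewrite fact1 invg1 mul1g mul1r big1 ?addr0 // => s /negPf s1.
by rewrite ffunE s1 fact0 mul0r.
Qed.

Lemma tw_mul1r : right_id tw_one tw_mul.
Proof.
move=> f; apply/ffunP=> r; rewrite ffunE (bigD1 r) //= ffunE mulVg eqxx.
rewrite fact_id mulr1 big1 ?addr0 // => s s_r; rewrite ffunE.
by rewrite -eq_invg_mul invgK (negPf s_r) mulr0.
Qed.

Lemma tw_mulDl : left_distributive tw_mul +%R.
Proof.
move=> f g u; apply/ffunP=> r; rewrite !ffunE -big_split.
by apply: eq_bigr => s _; rewrite ffunE factD mulrDl.
Qed.

Lemma tw_mulDr : right_distributive tw_mul +%R.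
Proof.
move=> f g u; apply/ffunP=> r; rewrite !ffunE -big_split.
by apply: eq_bigr => s _; rewrite ffunE mulrDr.
Qed.

Lemma tw_one_neq0 : tw_one != 0.
Proof. by apply/eqP=> /ffunP/(_ 1%g)/eqP; rewrite !ffunE eqxx oner_eq0. Qed.

HB.instance Definition _ := GRing.Zmodule_isNzRing.Build LG
  tw_mulA tw_mul1l tw_mul1r tw_mulDl tw_mulDr tw_one_neq0.

Lemma tw_scaleAl (k : K) f g : k *: (f * g) = (k *: f) * g.
Proof.
apply/ffunP=> r; rewrite !ffunE scaler_sumr; apply: eq_bigr => s _.
by rewrite ffunE factZ scalerAl.
Qed.

HB.instance Definition _ := GRing.Lmodule_isLalgebra.Build K LG tw_scaleAl.

Lemma tw_scaleAr (k : K) f g : k *: (f * g) = f * (k *: g).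
Proof.
apply/ffunP=> r; rewrite !ffunE scaler_sumr; apply: eq_bigr => s _.
by rewrite ffunE scalerAr.
Qed.

HB.instance Definition _ := GRing.Lalgebra_isAlgebra.Build K LG tw_scaleAr.
HB.instance Definition _ := Algebra_isFalgebra.Build K LG.

Lemma tw_mulE s t y z : tw s y * tw t z = tw (s * t)%g (to y t * z).
Proof.
apply/ffunP=> r; rewrite !ffunE (bigD1 s) //= !ffunE eqxx.
rewrite big1 ?addr0 => [|u /negPf us]; last by rewrite ffunE us fact0 mul0r.
rewrite -(inj_eq (mulgI s)) mulKVg; case: eqP => [->|_]; rewrite ?mulr0 //.
by rewrite mulKg.
Qed.

End TwistedGroupRing.


Section RightModules.

Variables (K : fieldType) (A : falgType K).

(* Right A-modules of finite K-dimension, which every simple one has; the     *)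
(* K-structure is the restriction of the A-structure along K -> A.            *)
Record rmodule := RModule {
  rm_sort :> vectType K;
  ract : rm_sort -> A -> rm_sort;
  ract_linearl : forall a, linear (ract^~ a);
  ract_linearr : forall x, linear (ract x);
  ract1 : forall x, ract x 1 = x;
  ractM : forall x a b, ract x (a * b) = ract (ract x a) b
}.

Definition submodule (M : rmodule) (U : {vspace M}) :=
  forall x a, x \in U -> ract x a \in U.

Definition rm_simple (M : rmodule) :=
  (fullv : {vspace M}) != 0%VS /\
  forall U : {vspace M}, submodule U -> U = 0%VS \/ U = fullv.

Definition rm_isomorphic (M M' : rmodule) :=
  exists f : {linear M -> M'},
    bijective f /\ forall x a, f (ract x a) = ract (f x) a.

Record smodule := SModule { sm_mod :> rmodule; smP : rm_simple sm_mod }.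

Section Action.

Variables (M : rmodule) (a : A).

Definition ract_by (x : M) : M := ract x a.
Lemma ract_by_linear : linear ract_by. Proof. exact: ract_linearl. Qed.
HB.instance Definition _ := GRing.isSemilinear.Build K M M _ ract_by
  (GRing.semilinear_linear ract_by_linear).

Definition ractf : 'End(M) := linfun ract_by.
Lemma ractfE x : ractf x = ract x a. Proof. exact: lfunE. Qed.

Definition ract_comm (f : 'End(M)) : 'End(M) :=
  ((f \o ractf) - (ractf \o f))%VF.
Lemma ract_comm_linear : linear ract_comm.
Proof.
move=> k f g; apply/lfunP=> x.
by rewrite !lfun_simp linearP scalerBr opprD addrACA.
Qed.
HB.instance Definition _ := GRing.isSemilinear.Build K _ _ _ ract_comm
  (GRing.semilinear_linear ract_comm_linear).

End Action.

(* Commutation with a basis of A, hence with A; see endo_spaceP.              *)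
Definition endo_space (M : rmodule) : {vspace 'End(M)} :=
  (\bigcap_(i < \dim {:A}) lker (linfun (@ract_comm M (vbasis {:A})`_i)))%VS.

Lemma endo_spaceP (M : rmodule) (f : 'End(M)) :
  reflect (forall x a, f (ract x a) = ract (f x) a) (f \in endo_space M).
Proof.
have memE a : (f \in lker (linfun (@ract_comm M a))) = (ract_comm a f == 0).
  by rewrite memv_ker lfunE.
have cE a x : ract_comm a f x = f (ract x a) - ract (f x) a.
  by rewrite /ract_comm !lfun_simp.
have ract0 x : ract x 0 = 0.
  rewrite -[X in ract x X](subrr 0) -scaleN1r addrC ract_linearr.
  by rewrite scaleN1r addNr.
have ract_sum x I (r : seq I) (P : pred I) F :
    ract x (\sum_(i <- r | P i) F i) = \sum_(i <- r | P i) ract x (F i).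
  apply: (big_morph (ract x)) => [b c|]; last exact: ract0.
  by rewrite -[b]scale1r ract_linearr !scale1r.
have ractZ x k a : ract x (k *: a) = k *: ract x a.
  by rewrite -[k *: a]addr0 ract_linearr ract0 addr0.
apply: (iffP subv_bigcapP) => [cf x a | cf i _].
  rewrite (coord_vbasis (memvf a)) !ract_sum linear_sum; apply: eq_bigr => i _.
  rewrite !ractZ linearZ; congr (_ *: _); apply/eqP.
  rewrite -subr_eq0 -cE; move: (cf i isT); rewrite -memvE memE => /eqP->.
  by rewrite lfunE.
by rewrite -memvE memE; apply/eqP/lfunP=> x; rewrite cE cf subrr lfunE.
Qed.

(* End_A(M) for a simple module M, acting on M from the left.                 *)
Section Endomorphisms.

Variable M : smodule.

Definition endo : Type := subvs_of (endo_space M).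
HB.instance Definition _ := Vector.on endo.

Definition endo_app (f : endo) : M -> M := vsval f.

Lemma endo_appP (f : endo) x a : endo_app f (ract x a) = ract (endo_app f x) a.
Proof. exact: (endo_spaceP _ (subvsP f)). Qed.

Fact endo_one_subproof : \1%VF \in endo_space M.
Proof. by apply/endo_spaceP=> x a; rewrite !id_lfunE. Qed.
Definition endo_one : endo := Subvs endo_one_subproof.

Fact endo_mul_subproof (f g : endo) :
  (vsval f \o vsval g)%VF \in endo_space M.
Proof.
apply/endo_spaceP=> x a; rewrite !comp_lfunE.
by rewrite (endo_spaceP _ (subvsP g)) (endo_spaceP _ (subvsP f)).
Qed.
Definition endo_mul (f g : endo) : endo := Subvs (endo_mul_subproof f g).

Lemma endo_mulA : associative endo_mul.
Proof. by move=> f g u; apply/val_inj/comp_lfunA. Qed.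
Lemma endo_mul1l : left_id endo_one endo_mul.
Proof. by move=> f; apply/val_inj/comp_lfun1l. Qed.
Lemma endo_mul1r : right_id endo_one endo_mul.
Proof. by move=> f; apply/val_inj/comp_lfun1r. Qed.
Lemma endo_mulDl : left_distributive endo_mul +%R.
Proof. by move=> f g u; apply/val_inj/comp_lfunDl. Qed.
Lemma endo_mulDr : right_distributive endo_mul +%R.
Proof. by move=> f g u; apply/val_inj/comp_lfunDr. Qed.
Lemma endo_one_neq0 : endo_one != 0.
Proof.
apply/eqP=> /(congr1 vsval)/= id0; have [/eqP[]] := smP M.
apply/vspaceP=> x; rewrite memvf memv0; apply/esym/eqP.
by rewrite -[x]id_lfunE id0 lfunE.
Qed.

HB.instance Definition _ := GRing.Zmodule_isNzRing.Build endo
  endo_mulA endo_mul1l endo_mul1r endo_mulDl endo_mulDr endo_one_neq0.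

Lemma endo_scaleAl (k : K) (f g : endo) : k *: (f * g) = (k *: f) * g.
Proof. by apply/val_inj; rewrite /= comp_lfunZl. Qed.
HB.instance Definition _ := GRing.Lmodule_isLalgebra.Build K endo endo_scaleAl.

Lemma endo_scaleAr (k : K) (f g : endo) : k *: (f * g) = f * (k *: g).
Proof. by apply/val_inj; rewrite /= comp_lfunZr. Qed.
HB.instance Definition _ := GRing.Lalgebra_isAlgebra.Build K endo endo_scaleAr.
HB.instance Definition _ := Algebra_isFalgebra.Build K endo.

Lemma endo_appM (f g : endo) x : endo_app (f * g) x = endo_app f (endo_app g x).
Proof. exact: comp_lfunE. Qed.

Variable n : nat.

(* M is a free left module over the skew field endo, with basis e.            *)
Definition endo_basis (e : 'I_n -> M) :=
  forall x, exists! c : 'rV[endo]_n, x = \sum_b endo_app (c 0 b) (e b).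

(* om xi is the matrix of xi with respect to the endo-basis e.                *)
Definition matrix_operation (e : 'I_n -> M) (om : A -> 'M[endo]_n) :=
  forall xi a, ract (e a) xi = \sum_b endo_app (om xi a b) (e b).

End Endomorphisms.

End RightModules.

Section ReducedTrace.

Variables (K : fieldType) (D : falgType K).

Definition center : falgType K := subvs_of 'Z({:D})%AS.

(* rho induces an isomorphism from the extension of scalars of D along phi to *)
(* the d x d matrices over F: it is surjective, and dimensions agree.         *)
Definition splitting (d : nat) (F : fieldType) (phi : {rmorphism center -> F})
    (rho : {rmorphism D -> 'M[F]_d}) :=
  [/\ (d ^ 2 = \dim_('Z({:D})) {:D})%N,
      forall z : center, rho (vsval z) = (phi z)%:M &
      forall M : 'M[F]_d, exists c : 'I_(\dim {:D}) -> F,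
        M = \sum_i c i *: rho (vbasis {:D})`_i].

(* t is the reduced trace of the central simple algebra D.  It does not       *)
(* depend on the chosen splitting.                                            *)
Definition reduced_trace (t : D -> center) :=
  exists (d : nat) (F : fieldType) (phi : {rmorphism center -> F})
    (rho : {rmorphism D -> 'M[F]_d}),
    splitting phi rho /\ forall u, phi (t u) = \tr (rho u).

End ReducedTrace.

(* Main.v *)
(** In L wr G the families sigma y_l and y_l^* sigma^-1 are dual bases for the
    symmetric form (a, b) |-> Tr_{L/K} of the coefficient of 1 in a b.  Hence
    the Casimir tensor, the sum of the sigma y_l (x) y_l^* sigma^-1, satisfies
    a C = C a, and averaging along it turns K-linear maps between modules into
    module homomorphisms; Schur's lemma gives the relations for i <> i'.

    For i = i', a splitting of K_i turns X_i into an absolutely irreducible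
    representation R of dimension m = x_i d_i over a field F, in which the
    averaged matrices are scalar.  So the sums of the products
    R(sigma y_l)_{ab} R(y_l^* sigma^-1)_{cd} are constant multiples c of
    delta_{ad} delta_{bc}.  To find c, take z in L with Tr z = 1: the sum of the
    sigma y_l z y_l^* sigma^-1 is n, which gives c tr R(z) = n.  Over a common
    extension of F and L, R decomposes under L into h eigenspaces, one for each
    conjugate embedding of L; they are permuted transitively by G, so all have
    dimension m/h, and tr R(z) = m/h.  In particular m/h is invertible. *)

Require Import Defs.
From HB Require Import structures.
From mathcomp Require Import all_boot all_algebra all_fingroup all_field.
From Stdlib Require Import Classical_Prop.

Set Implicit Arguments.
Unset Strict Implicit.
Unset Printing Implicit Defensive.

Import GRing.Theory.
Local Open Scope ring_scope.

(* [ract] is also the name of the restriction of an action in fingroup. *)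
Local Notation ract := Defs.ract.

(** * Traces and composita of fields *)

Lemma alg_traceE (K : fieldType) (A : falgType K) (a : A) :
  alg_trace a =
    \sum_(i < \dim {:A}) coord (vbasis {:A}) i (a * (vbasis {:A})`_i).
Proof.
by apply: eq_bigr => i _; rewrite !mxE /= passmx.vecof_delta lfunE.
Qed.

(** Substituting the expansion along [b] into the basis trace and exchanging the sums is the rule
    tr(XY) = tr(YX). This frees the trace from [vbasis]: below it is computed in a basis moved by a
    group element, and in [y]. *)
Lemma alg_trace_frame (K : fieldType) (A : falgType K) (I : finType)
    (b : I -> A) (f : I -> {linear A -> K^o}) (a : A) :
  (forall c, c = \sum_l f l c *: b l) ->
  alg_trace a = \sum_l f l (a * b l).
Proof.
move=> bf; rewrite alg_traceE; set vb := vbasis _.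
under eq_bigr => i _ do rewrite {1}[a * _]bf linear_sum.
rewrite exchange_big /=; apply: eq_bigr => l _.
rewrite {2}[b l](coord_vbasis (memvf _)) mulr_sumr linear_sum /=.
by apply: eq_bigr => i _; rewrite -scalerAr !linearZ /= mulrC.
Qed.

Lemma alg_trace_linear (K : fieldType) (A : falgType K) :
  linear (@alg_trace K A : A -> K^o).
Proof.
move=> k a b; rewrite !alg_traceE scaler_sumr -big_split /=.
by apply: eq_bigr => i _; rewrite mulrDl -scalerAl linearP.
Qed.

HB.instance Definition _ (K : fieldType) (A : falgType K) :=
  GRing.isSemilinear.Build K A K^o _ (@alg_trace K A)
    (GRing.semilinear_linear (@alg_trace_linear K A)).

Lemma alg_traceZ (K : fieldType) (A : falgType K) k (a : A) :
  alg_trace (k *: a) = k * alg_trace a.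
Proof. exact: linearZ_LR. Qed.

Lemma alg_traceB (K : fieldType) (A : falgType K) (a b : A) :
  alg_trace (a - b) = alg_trace a - alg_trace b.
Proof. exact: raddfB. Qed.

Lemma alg_trace_sum (K : fieldType) (A : falgType K) (I : finType)
    (F : I -> A) :
  alg_trace (\sum_i F i) = \sum_i alg_trace (F i).
Proof. exact: raddf_sum. Qed.

Lemma irreducible_factor (F : fieldType) (p : {poly F}) :
  (1 < size p)%N -> exists2 q : {poly F}, irreducible_poly q & q %| p.
Proof.
have [n] := ubnP (size p); elim: n p => // n IHn p /ltnSE pn p_gt1.
have p_neq0: p != 0 by rewrite -size_poly_gt0 ltnW.
(* Irreducibility over an arbitrary field is undecidable, hence the classical case distinction. *)
case: (classic (irreducible_poly p)) => [p_irr|p_red]; first by exists p.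
suff [q [q1 qp qlt]]: exists q : {poly F},
    [/\ (1 < size q)%N, q %| p & (size q < size p)%N].
  have [//|r r_irr rq] := IHn q (leq_trans qlt pn).
  by exists r; rewrite ?(dvdp_trans rq).
apply: NNPP => no_q; apply: p_red; split=> // q q_neq1 qp.
apply: contraT => q'p.
case: no_q; exists q; split=> //.
  rewrite ltn_neqAle eq_sym q_neq1 size_poly_gt0.
  apply: contraNneq p_neq0 => q0.
  by rewrite q0 dvd0p in qp.
by rewrite ltn_neqAle dvdp_leq // andbT dvdp_size_eqp.
Qed.

(** L is K(t) for a separable generator t. Adjoining to F a root [al] of an irreducible factor of
    the image of its minimal polynomial and sending t to [al] extends [phi] to L. *)
Lemma separable_compositum (K F : fieldType) (L : fieldExtType K)
    (phi : {rmorphism K -> F}) :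
  separable 1 {:L} ->
  exists (E : fieldExtType F) (psi : {rmorphism L -> E}),
    forall k : K, psi k%:A = (phi k)%:A.
Proof.
move=> sepL; pose t := separable_generator 1 {:L}%VS.
have fullt: <<1; t>>%VS = {:L}%VS.
  by rewrite -eq_adjoin_separable_generator ?sub1v.
have /polyOver1P[p0 p0E] := minPolyOver 1 t.
have p0_gt1: (1 < size (map_poly phi p0))%N.
  by rewrite size_map_poly -(size_map_poly (in_alg L)) -p0E size_minPoly ltnS.
have [q q_irr qp] := irreducible_factor p0_gt1.
have [E _ [al qal _]] := irredp_FAdjoin q_irr.
pose ev (p : {poly K}) : E := (map_poly (in_alg E) (map_poly phi p)).[al].
have ev_kill p : (map_poly (in_alg L) p).[t] = 0 -> ev p = 0.
  move=> pt0; apply/eqP.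
  have: p0 %| p.
    rewrite -(dvdp_map (in_alg L)) -p0E minPoly_dvdp ?/root ?pt0 //.
    by apply/polyOver1P; exists p.
  rewrite -(dvdp_map phi) => /(dvdp_trans qp); rewrite -(dvdp_map (in_alg E)).
  by move=> qp'; apply: (root_dvdp _ qal).
have polyL (u : L) : exists p : {poly K}, (map_poly (in_alg L) p).[t] == u.
  have: u \in <<1; t>>%VS by rewrite fullt memvf.
  case/Fadjoin_polyP=> r /polyOver1P[p ->] ->; exists p; exact: eqxx.
(* [lf] picks a polynomial in t representing u. By [ev_kill] the value of [ev] does not depend on
   the choice, so [psi] below is a ring morphism. *)
pose lf (u : L) := xchoose (polyL u).
have lfE u : (map_poly (in_alg L) (lf u)).[t] = u.
  exact/eqP/(xchooseP (polyL u)).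
have evB p q' : ev (p - q') = ev p - ev q' by rewrite /ev !rmorphB !hornerE.
have evE p u : (map_poly (in_alg L) p).[t] = u -> ev (lf u) = ev p.
  move=> pu; apply/eqP; rewrite -subr_eq0 -evB; apply/eqP/ev_kill.
  by rewrite rmorphB !hornerE lfE pu subrr.
pose psi u := ev (lf u).
have psiB : additive psi.
  move=> u v; rewrite /psi -evB; apply: evE.
  by rewrite rmorphB !hornerE !lfE.
have psiM : GRing.monoid_morphism psi.
  split=> [|u v]; rewrite /psi.
    rewrite (@evE 1); first by rewrite /ev !rmorph1 hornerC.
    by rewrite rmorph1 hornerC.
  rewrite (@evE (lf u * lf v)); first by rewrite /ev !rmorphM hornerM.
  by rewrite rmorphM hornerM !lfE.
pose psiA := GRing.isZmodMorphism.Build L E psi psiB.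
pose psiMM := GRing.isMonoidMorphism.Build L E psi psiM.
pose psiR : {rmorphism L -> E} := HB.pack psi psiA psiMM.
exists E, psiR => k /=; rewrite /psi (@evE k%:P) ?map_polyC ?hornerC //.
by rewrite /ev !map_polyC hornerC.
Qed.

(** * Dual bases of the field extension *)

(** Both sides expand to the double sum of [gam i j] times [B (u j) (v i)]. This is the common
    source of all moves of an element across a dual-basis tensor: [gam] is the matrix of a K-linear
    map on one family and of its adjoint on the other. *)
Lemma dual_swap (K : fieldType) (U V : lmodType K) (W : zmodType) (I : finType)
    (u u' : I -> U) (v v' : I -> V) (gam : I -> I -> K) (B : U -> V -> W) :
    (forall b, {morph B^~ b : x y / x + y}) ->
    (forall a, {morph B a : x y / x + y}) ->
    (forall k a b, B (k *: a) b = B a (k *: b)) ->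
    (forall i, u' i = \sum_j gam i j *: u j) ->
    (forall j, v' j = \sum_i gam i j *: v i) ->
  \sum_i B (u' i) (v i) = \sum_j B (u j) (v' j).
Proof.
move=> BD1 BD2 BZ u'E v'E.
have B0l b : B 0 b = 0 by apply: (addIr (B 0 b)); rewrite -BD1 !add0r.
have B0r a : B a 0 = 0 by apply: (addIr (B a 0)); rewrite -BD2 !add0r.
under eq_bigr => i _ do rewrite u'E (big_morph _ (BD1 _) (B0l _)).
under [RHS]eq_bigr => j _ do rewrite v'E (big_morph _ (BD2 _) (B0r _)).
by rewrite exchange_big; do 2!apply: eq_bigr => ? _; rewrite BZ.
Qed.

Lemma coef_prod_XsubC_stable (R : comNzRingType) (f : {rmorphism R -> R})
    (r : seq R) i :
  perm_eq (map f r) r ->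
  f (\prod_(w <- r) ('X - w%:P))`_i = (\prod_(w <- r) ('X - w%:P))`_i.
Proof.
by move=> rP; rewrite -coef_map map_prod_XsubC -[in RHS](perm_big _ rP) big_map.
Qed.

Section FieldActionRing.
Variables (K : fieldType) (L : fieldExtType K) (gT : finGroupType).
Variables (to : field_action L gT) (s : gT).

Definition fact_fun (y : L) : L := to y s.

Lemma fact_fun_linear : linear fact_fun.
Proof. by move=> k y z; rewrite /fact_fun factD factZ. Qed.
HB.instance Definition _ := GRing.isSemilinear.Build K L L _ fact_fun
  (GRing.semilinear_linear fact_fun_linear).

Lemma fact_fun_monoid : GRing.monoid_morphism fact_fun.
Proof. by split=> [|y z]; [apply: fact1 | apply: factM]. Qed.
HB.instance Definition _ :=
  GRing.isMonoidMorphism.Build L L fact_fun fact_fun_monoid.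

End FieldActionRing.

(** * Galois theory of the action on L *)

Section Galois.
Variables (K : fieldType) (L : fieldExtType K) (gT : finGroupType).
Variables (to : field_action L gT).

Lemma factKV (s : gT) : cancel (to^~ s) (to^~ s^-1%g).
Proof. by move=> z; rewrite -factA mulgV fact_id. Qed.

Lemma factVK (s : gT) : cancel (to^~ s^-1%g) (to^~ s).
Proof. by move=> z; rewrite -factA mulVg fact_id. Qed.

(** The element s carries a basis to a basis whose coordinate functions are the old ones after s^-1,
    so both bases produce the same sum. *)
Lemma alg_trace_fact z s : alg_trace (to z s) = alg_trace z :> K.
Proof.
rewrite [RHS]alg_traceE; set vb := vbasis _.
pose f l : {linear L -> K^o} := coord vb l \o fact_fun to s^-1%g.
rewrite (@alg_trace_frame _ _ 'I_(\dim {:L}) (fun l => to vb`_l s) f) => [|c].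
  by apply: eq_bigr => l _; rewrite /f /= /fact_fun -factM factKV.
rewrite -[LHS](factVK s) {1}(coord_vbasis (memvf (to c _))) fact_sum.
by apply: eq_bigr => l _; rewrite factZ.
Qed.

(** Each z is a root of the product of the X - w over its distinct conjugates w. G permutes these
    roots, so the coefficients are fixed and lie in K. *)
Lemma fact_separable : separable 1 {:L}.
Proof.
apply/separableP=> z _; apply/separable_elementP.
pose r := undup [seq to z s | s : gT].
exists (\prod_(w <- r) ('X - w%:P)); split; last first.
- by rewrite separable_prod_XsubC undup_uniq.
- rewrite root_prod_XsubC mem_undup; apply/imageP; exists 1%g => //.
  by rewrite fact_id.
apply/polyOverP=> i; apply/(fact_fixed to) => s.
rewrite -[to _ s]/(fact_fun to s _).
apply: coef_prod_XsubC_stable; apply: uniq_perm.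
- rewrite map_inj_uniq ?undup_uniq //; exact: (can_inj (factKV s)).
- exact: undup_uniq.
move=> w; apply/mapP/idP=> [[v]|].
  rewrite !mem_undup => /imageP[t _ ->] ->.
  apply/imageP; exists (t * s)%g => //.
  by rewrite factA.
rewrite mem_undup => /imageP[t _ ->]; exists (to z (t * s^-1)%g).
  by rewrite mem_undup; apply/imageP; exists (t * s^-1)%g.
by rewrite /= /fact_fun -factA mulgKV.
Qed.

Local Notation h := (\dim {:L}).
Variables (y ys : 'I_h -> L).
Hypothesis y_dual : forall l m, alg_trace (y l * ys m) = (l == m)%:R.
Hypothesis y_ys : forall z, z = \sum_l alg_trace (z * ys l) *: y l.
Hypothesis ys_y : forall z, z = \sum_l alg_trace (z * y l) *: ys l.

Lemma alg_trace_neq0 : exists z : L, alg_trace z = 1 :> K.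
Proof.
case: (classic (exists z : L, alg_trace z != 0 :> K)) => [[z z0]|all0].
  by exists ((alg_trace z)^-1 *: z); rewrite alg_traceZ mulVf.
suff /eqP : 1 = 0 :> L by rewrite oner_eq0.
rewrite [1]y_ys big1 // => l _; rewrite (_ : alg_trace _ = 0) ?scale0r //.
by apply/eqP/negPn/negP=> z0; apply: all0; exists (1 * ys l).
Qed.

Lemma alg_trace_nondeg (w : L) :
  (forall z, alg_trace (z * w) = 0 :> K) -> w = 0.
Proof.
by move=> w0; rewrite [w]y_ys big1 // => l _; rewrite mulrC w0 scale0r.
Qed.

(** Pairing the sum with z gives the sum of the Tr(z y_l ys_l), which is the trace of z computed in
    the basis [y]. So the sum and 1 pair equally with every z. *)
Lemma sum_dual1 : \sum_l y l * ys l = 1.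
Proof.
apply/eqP; rewrite -subr_eq0; apply/eqP/alg_trace_nondeg => z.
pose f l : {linear L -> K^o} := @alg_trace K L \o amulr (ys l).
rewrite mulrBr mulr1 alg_traceB [in X in _ - X](@alg_trace_frame _ _ _ y f);
    last first=> [c|].
  by rewrite {1}[c]y_ys; apply: eq_bigr => l _; rewrite /f /= lfunE.
rewrite mulr_sumr alg_trace_sum -sumrB big1 // => l _.
by rewrite /f /= lfunE /= mulrA subrr.
Qed.

(** Multiplication by z is self-adjoint for the trace form. *)
Lemma dual_swap_mul (W : zmodType) (B : L -> L -> W) (z : L) :
    (forall b, {morph B^~ b : x y / x + y}) ->
    (forall a, {morph B a : x y / x + y}) ->
    (forall k a b, B (k *: a) b = B a (k *: b)) ->
  \sum_l B (z * y l) (ys l) = \sum_l B (y l) (z * ys l).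
Proof.
move=> BD1 BD2 BZ.
apply: (dual_swap (gam := fun i j => alg_trace (z * y i * ys j))) => //.
by move=> j; rewrite {1}[z * _]ys_y; apply: eq_bigr => i _; rewrite mulrAC.
Qed.

(** As the trace is G-invariant, the adjoint of s is its inverse. *)
Lemma dual_swap_fact (W : zmodType) (B : L -> L -> W) s :
    (forall b, {morph B^~ b : x y / x + y}) ->
    (forall a, {morph B a : x y / x + y}) ->
    (forall k a b, B (k *: a) b = B a (k *: b)) ->
  \sum_l B (to (y l) s) (ys l) = \sum_l B (y l) (to (ys l) s^-1%g).
Proof.
move=> BD1 BD2 BZ.
apply: (dual_swap (gam := fun i j => alg_trace (to (y i) s * ys j))) => //.
move=> j; rewrite {1}[to (ys j) _]ys_y; apply: eq_bigr => i _.
by rewrite -[in LHS](alg_trace_fact _ s) factM factVK mulrC.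
Qed.

(** Moving z across the dual bases shows that [to z s] and [to z t] have the same product with the
    sum, which can be cancelled when nonzero. *)
Lemma dual_orthogonal s t :
  \sum_l to (ys l) s * to (y l) t != 0 -> forall z, to z s = to z t.
Proof.
set w := \sum_l _ => w0 z; apply: (mulIf w0); rewrite /w !mulr_sumr.
under eq_bigr => l _ do rewrite mulrA -factM.
under [RHS]eq_bigr => l _ do rewrite mulrCA -factM.
rewrite -(@dual_swap_mul L (fun a b => to b s * to a t)) //
  => [b u v|a u v|k a b].
- by rewrite /= factD mulrDr.
- by rewrite /= factD mulrDl.
- by rewrite /= !factZ -scalerAl -scalerAr.
Qed.

Variable N : {set gT}.
Hypothesis kerN : forall s, s \in N <-> (forall y, to y s = y).
Hypothesis N_neq0 : #|N|%:R != 0 :> K.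

(** The cosets of N give the h distinct automorphisms of L induced by G, and these sum to the trace.
    The sum over a transversal is a G-invariant functional, hence a multiple of the trace;
    orthogonality then fixes the factor and the number of cosets. *)
Lemma coset_representatives : exists r : 'I_h -> gT,
  [/\ forall i j, (forall z, to z (r i) = to z (r j)) -> i = j,
      forall z, \sum_i to z (r i) = (alg_trace z)%:A &
      forall z, \sum_s to z s = (alg_trace z *+ #|N|)%:A].
Proof.
have gN : group_set N.
  apply/group_setP; split=> [|s t /kerN sN /kerN tN]; apply/kerN => z.
    by rewrite fact_id.
  by rewrite factA sN tN.
pose G := Group gN; pose rp s := repr (G :* s)%g.
have rpN s : (rp s * s^-1)%g \in N by rewrite -mem_rcoset mem_repr_rcoset.
have sameN s t : (forall z, to z s = to z t) <-> (s * t^-1)%g \in N.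
  split=> [st|/kerN stN z].
    by apply/kerN => z; rewrite factA st factKV.
  by rewrite -{2}[z]stN -factA mulgKV.
have same_rp s t : (rp s == rp t) = ((s * t^-1)%g \in N).
  have [GE|GE] := eqVneq; last first.
    apply/esym/negbTE; apply: contraNN GE => stN; apply/eqP; congr (repr _).
    by apply/rcoset_eqP; rewrite mem_rcoset.
  apply/esym/sameN=> z; rewrite -((sameN _ _).2 (rpN s)) GE.
  exact: (sameN _ _).2 (rpN t) z.
pose T := [set rp s | s : gT].
have rpT t : t \in T -> rp t = t.
  by case/imsetP=> s _ ->; apply/eqP; rewrite same_rp rpN.
have sumN z : \sum_s to z s = (\sum_(s in T) to z s) *+ #|N|.
  rewrite (partition_big rp (mem T)) => [|s _]; last exact: imset_f.
  rewrite -sumrMnl; apply: eq_bigr => t tT.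
  rewrite -(card_rcoset N t) -sumr_const [RHS]big_mkcond [LHS]big_mkcond.
  apply: eq_bigr => s _; rewrite mem_rcoset -same_rp (rpT t tT) /=.
  case: eqP => // rpst; apply: (sameN _ _).2; rewrite -same_rp rpst.
  by rewrite rpT.
pose Tr' z := \sum_(s in T) to z s.
(* Division by n turns the transversal sum into a sum over all of G, where reindexing gives
   invariance from both sides. *)
have Tr'E z : Tr' z = #|N|%:R^-1 *: \sum_s to z s.
  by rewrite sumN -scaler_nat scalerA mulVf ?scale1r.
have Tr'to z s : Tr' (to z s) = Tr' z.
  rewrite !Tr'E [in RHS](reindex_inj (mulgI s)).
  by congr (_ *: _); apply: eq_bigr => t _; rewrite factA.
have Tr'P z : exists k : K, Tr' z = k%:A.
  suff /vlineP[k ->] : Tr' z \in 1%VS by exists k.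
  apply/(fact_fixed to) => s; rewrite !Tr'E factZ fact_sum.
  rewrite [in RHS](reindex_inj (mulIg s)).
  by congr (_ *: _); apply: eq_bigr => t _; rewrite factA.
have Tr'D : {morph Tr' : z w / z + w}.
  by move=> z w; rewrite /Tr' -big_split; apply: eq_bigr => s _; rewrite factD.
have Tr'Z k z : Tr' (k *: z) = k *: Tr' z.
  by rewrite /Tr' scaler_sumr; apply: eq_bigr => s _; rewrite factZ.
have Tr'0 : Tr' 0 = 0 by rewrite -[0 in LHS](scale0r 0) Tr'Z scale0r.
(* [c] represents the functional [Tr'] in the trace form: [Tr' z] is Tr(zc). Invariance of [Tr']
   makes [c] fixed by G, hence a scalar k. *)
pose c := \sum_l Tr' (y l) * ys l.
have /vlineP[k cE] : c \in 1%VS.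
  apply/(fact_fixed to) => s; rewrite fact_sum.
  pose B a b : L := Tr' a * b.
  transitivity (\sum_l B (y l) (to (ys l) s^-1%g^-1%g)).
    apply: eq_bigr => l _; rewrite factM invgK; congr (_ * _).
    by have [k ->] := Tr'P (y l); rewrite factZ fact1.
  rewrite -dual_swap_fact => [|b u v|a u v|k a b].
  - by apply: eq_bigr => l _; rewrite /B Tr'to.
  - by rewrite /B Tr'D mulrDl.
  - by rewrite /B mulrDr.
  - by rewrite /B Tr'Z -scalerAl scalerAr.
have sum_tr : \sum_l alg_trace (ys l) *: y l = 1.
  by rewrite [RHS]y_ys; apply: eq_bigr => l _; rewrite mul1r.
have Tr'_tr z : Tr' z = (k * alg_trace z)%:A.
  pose B a b : L := Tr' a * b.
  have zcE : z * c = \sum_l Tr' (z * y l) * ys l.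
    rewrite mulr_sumr -[RHS]/(\sum_l B (z * y l) (ys l)) dual_swap_mul.
    - by apply: eq_bigr => l _; rewrite /B mulrCA.
    - by move=> b u v; rewrite /B Tr'D mulrDl.
    - by move=> a u v; rewrite /B mulrDr.
    - by move=> k' a b; rewrite /B Tr'Z -scalerAl scalerAr.
  have: (alg_trace (z * c))%:A = k *: (alg_trace z)%:A :> L.
    by rewrite cE -scalerAr mulr1 alg_traceZ scalerA.
  rewrite zcE alg_trace_sum scaler_suml scalerA => <-.
  rewrite -[in LHS](mulr1 z) -[in LHS]sum_tr mulr_sumr (big_morph _ Tr'D Tr'0).
  apply: eq_bigr => l _; rewrite -scalerAr Tr'Z.
  have [k' ->] := Tr'P (z * y l).
  by rewrite mulr_algl alg_traceZ !scalerA mulrC.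
have orth s t : s \in T -> t \in T ->
    \sum_l to (ys l) s * to (y l) t = (s == t)%:R.
  move=> sT tT; have [->|st] := eqVneq s t.
    under eq_bigr => l _ do rewrite -factM mulrC.
    by rewrite -fact_sum sum_dual1 fact1.
  apply: contraNeq st => /dual_orthogonal/sameN.
  by rewrite -same_rp !rpT.
(* The sum below is 1 by orthogonality, only the coset of 1 contributing; replacing [Tr'] by k times
   the trace, it is k. *)
have k1 : k = 1.
  have: \sum_l Tr' (ys l) * to (y l) (rp 1%g) = 1.
    under eq_bigr => l _ do rewrite mulr_suml.
    rewrite exchange_big (bigD1 (rp 1%g)) ?imset_f //= orth ?imset_f // eqxx.
    rewrite big1 ?addr0 // => s /andP[sT s1].
    by rewrite orth ?imset_f // (negPf s1).
  under eq_bigr => l _ do rewrite Tr'_tr mulr_algl -scalerA -factZ.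
  rewrite -scaler_sumr -fact_sum sum_tr fact1 => /eqP.
  rewrite -[X in _ == X]scale1r -subr_eq0 -scalerBl scaler_eq0 oner_eq0 orbF.
  by rewrite subr_eq0 => /eqP.
(* The matrices of conjugates of [y] and [ys] are inverse to each other on both sides, so they are
   square. *)
have hT : #|T| = h.
  pose Y : 'M[L]_(h, #|T|) := \matrix_(l, i) to (y l) (enum_val i).
  pose Z : 'M[L]_(#|T|, h) := \matrix_(i, l) to (ys l) (enum_val i).
  have ZY : Z *m Y = 1%:M.
    apply/matrixP=> i j; rewrite !mxE.
    under eq_bigr => l _ do rewrite !mxE.
    by rewrite orth ?enum_valP // (inj_eq enum_val_inj).
  have YZ : Y *m Z = 1%:M.
    apply/matrixP=> l m; rewrite !mxE.
    under eq_bigr => i _ do rewrite !mxE -factM.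
    rewrite -(big_enum_val (fun s => to (y l * ys m) s)) -/(Tr' _) Tr'_tr.
    by rewrite k1 mul1r y_dual scaler_nat.
  by apply/eqP; rewrite eqn_leq (mulmx1_min ZY) (mulmx1_min YZ).
exists (fun i => enum_val (cast_ord (esym hT) i)); split.
- move=> i j /sameN; rewrite -same_rp !rpT ?enum_valP // => /eqP/enum_val_inj.
  exact: cast_ord_inj.
- move=> z; rewrite -[alg_trace z]mul1r -k1 -Tr'_tr /Tr' [RHS]big_enum_val.
  rewrite [RHS](reindex (cast_ord (esym hT))) //=; apply: onW_bij.
  by exists (cast_ord hT) => j; apply: val_inj.
by move=> z; rewrite sumN -/(Tr' z) Tr'_tr k1 mul1r scalerMnl.
Qed.
End Galois.

(** * Traces of representations *)

(** A vector of one row space lying in the sum of the others is both fixed and killed by its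
    idempotent, so the row spaces form a direct sum. *)
Lemma rank_orthogonal_idempotents (E : fieldType) m (I : finType)
    (P : I -> 'M[E]_m) :
  (forall i j, P i *m P j = if i == j then P i else 0) ->
  \sum_i P i = 1%:M -> m = (\sum_i \rank (P i))%N.
Proof.
move=> PP P1.
have dirP : mxdirect (\sum_i P i).
  apply/mxdirect_sumsP => i _; apply/eqP; rewrite -submx0.
  set D := (P i :&: _)%MS.
  have /submxP[X XE] : (D <= P i)%MS by apply: capmxSl.
  have DPi : D = D *m P i by rewrite XE -mulmxA PP eqxx.
  rewrite DPi; apply: submx_trans (submxMr (P i) (_ : D <= _)%MS) _.
    exact: capmxSr.
  rewrite sumsmxMr; apply/sumsmx_subP => j /= ji.
  by rewrite PP (negPf ji) sub0mx.
rewrite -(mxdirectP dirP) /=; apply/eqP; rewrite eqn_leq rank_leq_col andbT.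
by rewrite -{1}(mxrank1 E m) mxrankS // -P1 summx_sub_sums.
Qed.

(** Write P = CB with C of full column rank and B of full row rank. Cancelling both in CBCB = CB
    leaves BC = 1, of size the rank, and tr(CB) = tr(BC). *)
Lemma idempotent_trace (E : fieldType) m (P : 'M[E]_m) :
  P *m P = P -> \tr P = (\rank P)%:R.
Proof.
move=> PP.
have inv k (C : 'M[E]_(m, k)) (B : 'M_(k, m)) : row_full C -> row_free B ->
    C *m B *m (C *m B) = C *m B -> B *m C = 1%:M.
  move=> Cf Bf CBCB; apply: (row_full_inj Cf); apply: (row_free_inj Bf).
  by rewrite mulmx1 -[RHS]CBCB !mulmxA.
rewrite -{1}(mulmx_base P) mxtrace_mulC.
rewrite (inv _ _ _ (col_base_full P) (row_base_free P)) ?mulmx_base //.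
by rewrite mxtrace1.
Qed.

Section TwBasics.
Variables (K : fieldType) (L : fieldExtType K) (gT : finGroupType).
Variables (to : field_action L gT).

Lemma twD s : {morph tw to s : y z / y + z}.
Proof.
by move=> y z; apply/ffunP=> r; rewrite !ffunE; case: eqP; rewrite ?addr0.
Qed.

Lemma twZ s k y : tw to s (k *: y) = k *: tw to s y.
Proof.
by apply/ffunP=> r; rewrite !ffunE; case: eqP; rewrite ?scaler0.
Qed.

Lemma tw_sum s (I : finType) (F : I -> L) :
  tw to s (\sum_i F i) = \sum_i tw to s (F i).
Proof.
apply: (big_morph _ (twD s)).
by apply/ffunP=> r; rewrite !ffunE; case: eqP.
Qed.

Lemma tw11 : tw to 1%g 1 = 1.
Proof. by []. Qed.

Lemma twV s : tw to s 1 * tw to s^-1%g 1 = 1.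
Proof. by rewrite tw_mulE fact1 mulr1 mulgV. Qed.

End TwBasics.

Section Representation.
Variables (K : fieldType) (L : fieldExtType K) (gT : finGroupType).
Variables (to : field_action L gT).
Local Notation h := (\dim {:L}).
Variables (y ys : 'I_h -> L).
Hypothesis y_dual : forall l m, alg_trace (y l * ys m) = (l == m)%:R.
Hypothesis y_ys : forall z, z = \sum_l alg_trace (z * ys l) *: y l.
Hypothesis ys_y : forall z, z = \sum_l alg_trace (z * y l) *: ys l.
Variable N : {set gT}.
Hypothesis kerN : forall s, s \in N <-> (forall y, to y s = y).
Hypothesis N_neq0 : #|N|%:R != 0 :> K.

Variables (E : fieldType) (psi : {rmorphism L -> E}) (m : nat).
Variable R : twring to -> 'M[E]_m.
Hypothesis RD : {morph R : a b / a + b}.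
Hypothesis RM : forall a b, R (a * b) = R a *m R b.
Hypothesis R1 : R 1 = 1%:M.
Hypothesis RZ : forall k a, R (k *: a) = psi k%:A *: R a.

(* [Q s] is the image of the separability idempotent of L/K under
   [psi \o to^~ s] and [R], the projection onto the eigenspace of L for that
   embedding. *)
Lemma representation_trace : exists r, m = (h * r)%N /\
  forall z, \tr (R (tw to 1%g z)) = psi (alg_trace z)%:A * r%:R.
Proof.
have [r [r_inj r_tr _]] := coset_representatives y_dual y_ys ys_y kerN N_neq0.
have R0 : R 0 = 0 by apply: (addIr (R 0)); rewrite -RD !add0r.
have Rsum (I : finType) F : R (\sum_(i : I) F i) = \sum_i R (F i).
  exact: (big_morph R RD R0).
pose B s (a b : L) : 'M_m := psi (to b s) *: R (tw to 1%g a).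
pose Q s := \sum_l B s (y l) (ys l).
have BD1 s b : {morph (B s)^~ b : u v / u + v}.
  by move=> u v; rewrite /B twD RD scalerDr.
have BD2 s a : {morph B s a : u v / u + v}.
  by move=> u v; rewrite /B factD rmorphD scalerDl.
have BZ s k a b : B s (k *: a) b = B s a (k *: b).
  by rewrite /B factZ twZ RZ -[k *: to b s]mulr_algl rmorphM scalerA mulrC.
have RQ z s : R (tw to 1%g z) *m Q s = psi (to z s) *: Q s.
  rewrite /Q mulmx_sumr scaler_sumr.
  transitivity (\sum_l B s (z * y l) (ys l)).
    apply: eq_bigr => l _; rewrite -scalemxAr -RM tw_mulE mulg1.
    by rewrite fact_id.
  rewrite dual_swap_mul //; apply: eq_bigr => l _.
  by rewrite /B factM rmorphM scalerA.
have QQ s t : Q s *m Q t = psi (\sum_l to (ys l) s * to (y l) t) *: Q t.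
  rewrite {1}/Q mulmx_suml rmorph_sum scaler_suml; apply: eq_bigr => l _.
  by rewrite -scalemxAl RQ scalerA -rmorphM.
have RV s : R (tw to s 1) *m R (tw to s^-1%g 1) = 1%:M.
  by rewrite -RM twV.
have VR s : R (tw to s^-1%g 1) *m R (tw to s 1) = 1%:M.
  by rewrite -{2}[s]invgK RV.
(* All [Q s] are conjugate to [Q 1], so the eigenspaces have equal dimension. *)
have QE s : Q s = R (tw to s 1) *m Q 1%g *m R (tw to s^-1%g 1).
  rewrite /Q mulmx_sumr mulmx_suml.
  transitivity (\sum_l B 1%g (to (y l) s^-1%g) (ys l)).
    rewrite dual_swap_fact //; apply: eq_bigr => l _.
    by rewrite /B fact_id invgK.
  apply: eq_bigr => l _; rewrite -scalemxAr -scalemxAl -!RM !tw_mulE.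
  by rewrite mulg1 mulgV mulr1 fact1 mul1r.
have rankQ s : \rank (Q s) = \rank (Q 1%g).
  apply/eqP; rewrite eqn_leq {1}(QE s).
  rewrite (leq_trans (mxrankM_maxl _ _)) ?mxrankM_maxr //=.
  have -> : Q 1%g = R (tw to s^-1%g 1) *m Q s *m R (tw to s 1).
    by rewrite (QE s) !mulmxA VR mul1mx -mulmxA VR mulmx1.
  by rewrite (leq_trans (mxrankM_maxl _ _)) ?mxrankM_maxr.
have trQ s : \tr (Q s) = \tr (Q 1%g).
  by rewrite (QE s) mxtrace_mulC mulmxA VR mul1mx.
(* Summing over the representatives turns the coefficients into Tr(ys_l), and the sum of the
   Tr(ys_l) y_l is 1. *)
have sumQ : \sum_i Q (r i) = 1%:M.
  rewrite -R1 -tw11 [1 in RHS]y_ys tw_sum Rsum exchange_big /=.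
  apply: eq_bigr => l _; rewrite twZ RZ -scaler_suml -rmorph_sum r_tr.
  by rewrite mul1r.
have QrQr i j : Q (r i) *m Q (r j) = if i == j then Q (r i) else 0.
  rewrite QQ; have [->|ij] := eqVneq i j.
    under eq_bigr => l _ do rewrite -factM mulrC.
    by rewrite -fact_sum (sum_dual1 y_ys) fact1 rmorph1 scale1r.
  rewrite [X in psi X](_ : _ = 0) ?rmorph0 ?scale0r //.
  by apply: contraNeq ij => w0; apply/eqP/r_inj/(dual_orthogonal y_ys ys_y w0).
exists (\rank (Q 1%g)); split.
  rewrite [LHS](rank_orthogonal_idempotents QrQr sumQ).
  under eq_bigr => i _ do rewrite rankQ.
  by rewrite sum_nat_const card_ord.
move=> z; rewrite -[R _]mulmx1 -sumQ mulmx_sumr raddf_sum /=.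
rewrite -r_tr rmorph_sum mulr_suml; apply: eq_bigr => i _.
by rewrite RQ mxtraceZ trQ -(trQ (r i)) idempotent_trace ?rankQ // QrQr eqxx.
Qed.

End Representation.

(** * The Casimir tensor of the twisted group ring *)

Section Casimir.
Variables (K : fieldType) (L : fieldExtType K) (gT : finGroupType).
Variables (to : field_action L gT).
Local Notation h := (\dim {:L}).
Local Notation A := (twring to).

Lemma tw_mulEl t z (a : A) r :
  (tw to t z * a) r = to z (t^-1 * r)%g * a (t^-1 * r)%g.
Proof.
rewrite ffunE (bigD1 t) //= ffunE eqxx big1 ?addr0 // => s /negPf st.
by rewrite ffunE st Defs.fact0 mul0r.
Qed.

Lemma tw_expand (a : A) : a = \sum_s tw to s (a s).
Proof.
apply/ffunP=> r; rewrite sum_ffunE (bigD1 r) //= ffunE eqxx.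
by rewrite big1 ?addr0 // => s /negPf sr; rewrite ffunE eq_sym sr.
Qed.

Definition tw_form (a : A) : K := alg_trace (a 1%g).

(** After s is replaced by s^-1, corresponding summands of the two coefficients of 1 are conjugate
    under G, so they have the same trace. *)
Lemma tw_formC (a b : A) : tw_form (a * b) = tw_form (b * a).
Proof.
rewrite /tw_form !ffunE !alg_trace_sum (reindex_inj invg_inj).
apply: eq_bigr => s _ /=; rewrite !mulg1 invgK -(alg_trace_fact to _ s^-1%g).
by rewrite factM factKV mulrC.
Qed.

Variables (y ys : 'I_h -> L).
Hypothesis y_dual : forall l m, alg_trace (y l * ys m) = (l == m)%:R.
Hypothesis y_ys : forall z, z = \sum_l alg_trace (z * ys l) *: y l.
Hypothesis ys_y : forall z, z = \sum_l alg_trace (z * y l) *: ys l.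

Definition tw_basis (j : 'I_h * gT) : A := tw to j.2 (y j.1).
Definition tw_dual (j : 'I_h * gT) : A :=
  tw to 1%g (ys j.1) * tw to j.2^-1%g 1.

Lemma tw_dualE l s : tw_dual (l, s) = tw to s^-1%g (to (ys l) s^-1%g).
Proof. by rewrite /tw_dual tw_mulE mul1g mulr1. Qed.

Lemma tw_basis_expand a : a = \sum_j tw_form (tw_dual j * a) *: tw_basis j.
Proof.
rewrite -(pair_bigA _ (fun l s =>
  tw_form (tw_dual (l, s) * a) *: tw_basis (l, s))).
rewrite exchange_big /= [LHS]tw_expand; apply: eq_bigr => s _.
rewrite {1}[a s]y_ys tw_sum; apply: eq_bigr => l _; rewrite twZ; congr (_ *: _).
by rewrite tw_dualE /tw_form tw_mulEl invgK mulg1 factVK mulrC.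
Qed.

Lemma tw_dual_expand a : a = \sum_j tw_form (tw_basis j * a) *: tw_dual j.
Proof.
rewrite -(pair_bigA _ (fun l s =>
  tw_form (tw_basis (l, s) * a) *: tw_dual (l, s))).
rewrite exchange_big /= [LHS]tw_expand (reindex_inj invg_inj).
apply: eq_bigr => s _.
rewrite -{1}[a s^-1%g](factKV to s) {1}[to (a _) _]ys_y fact_sum tw_sum.
apply: eq_bigr => l _; rewrite factZ twZ tw_dualE; congr (_ *: _).
rewrite /tw_form tw_mulEl mulg1 -[RHS](alg_trace_fact to _ s).
by rewrite factM factVK mulrC.
Qed.

Section Swap.
Variables (W : zmodType) (B : A -> A -> W) (a : A).
Hypothesis BD1 : forall b, {morph B^~ b : x y / x + y}.
Hypothesis BD2 : forall a, {morph B a : x y / x + y}.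
Hypothesis BZ : forall k a b, B (k *: a) b = B a (k *: b).

(** Since the form is symmetric, left multiplication by a has right multiplication by a as its
    adjoint. *)
Lemma casimir_swap_out :
  \sum_j B (a * tw_basis j) (tw_dual j) = \sum_j B (tw_basis j) (tw_dual j * a).
Proof.
pose gam i j := tw_form (tw_dual j * (a * tw_basis i)).
apply: (dual_swap (gam := gam)) => //.
  by move=> i; rewrite {1}[a * _]tw_basis_expand.
move=> j; rewrite {1}[_ * a]tw_dual_expand; apply: eq_bigr => i _.
by rewrite /gam tw_formC -mulrA.
Qed.

Lemma casimir_swap_in :
  \sum_j B (tw_basis j * a) (tw_dual j) = \sum_j B (tw_basis j) (a * tw_dual j).
Proof.
pose gam i j := tw_form (tw_dual j * (tw_basis i * a)).
apply: (dual_swap (gam := gam)) => //.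
  by move=> i; rewrite {1}[_ * a]tw_basis_expand.
move=> j; rewrite {1}[a * _]tw_dual_expand; apply: eq_bigr => i _.
by rewrite /gam mulrA tw_formC.
Qed.

End Swap.

Variable N : {set gT}.
Hypothesis kerN : forall s, s \in N <-> (forall y, to y s = y).
Hypothesis N_neq0 : #|N|%:R != 0 :> K.

(** For fixed s the sum over l is z conjugated by s^-1, because the y_l ys_l sum to 1. Summing over
    s gives n times the trace. *)
Lemma casimir_sum z :
  \sum_j tw_basis j * tw to 1%g z * tw_dual j = (alg_trace z *+ #|N|)%:A.
Proof.
have [_ [_ _ trN]] := coset_representatives y_dual y_ys ys_y kerN N_neq0.
rewrite -[X in _ = _ *: X](tw11 to) -twZ -trN tw_sum (reindex_inj invg_inj) /=.
rewrite -(pair_bigA _ (fun l s =>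
  tw_basis (l, s) * tw to 1%g z * tw_dual (l, s))).
rewrite exchange_big /=; apply: eq_bigr => s _.
transitivity (tw to 1%g (to (\sum_l y l * ys l * z) s^-1%g)); last first.
  by rewrite -mulr_suml (sum_dual1 y_ys) mul1r.
rewrite fact_sum tw_sum; apply: eq_bigr => l _.
rewrite tw_dualE /tw_basis !tw_mulE !mulg1 mulgV fact_id.
by rewrite -factM mulrAC.
Qed.

(** * Schur relations for a matrix representation with scalar commutant *)

Variables (F : fieldType) (phi : {rmorphism K -> F}) (m : nat).
Variable R : A -> 'M[F]_m.
Hypothesis m_gt0 : (0 < m)%N.
Hypothesis RD : {morph R : a b / a + b}.
Hypothesis RM : forall a b, R (a * b) = R a *m R b.
Hypothesis R1 : R 1 = 1%:M.
Hypothesis RZ : forall k a, R (k *: a) = phi k *: R a.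
Hypothesis R_irr :
  forall C, (forall a, C *m R a = R a *m C) -> exists c, C = c%:M.

Lemma representation_trace_nat :
  forall z, \tr (R (tw to 1%g z)) = phi (alg_trace z) * (m %/ h)%:R.
Proof.
have [E [psi psiE]] := separable_compositum phi (fact_separable to).
pose R' a := map_mx (in_alg E) (R a).
have [||||r [mE trE]] := @representation_trace _ _ _ to _ _ y_dual y_ys ys_y
  N kerN N_neq0 E psi m R'.
- by move=> a b; rewrite /R' RD map_mxD.
- by move=> a b; rewrite /R' RM map_mxM.
- by rewrite /R' R1 map_mx1.
- by move=> k a; rewrite /R' RZ map_mxZ psiE.
have h_gt0 : (0 < h)%N by apply: adim_gt0.
have -> : (m %/ h)%N = r by rewrite mE mulKn.
move=> z.
apply: (fmorph_inj (in_alg E)); rewrite -trace_map_mx -/(R' _) trE psiE.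
by rewrite rmorphM rmorph_nat.
Qed.

Lemma representation_schur :
  forall a b c d, \sum_j R (tw_basis j) a b * R (tw_dual j) c d =
    phi (#|N|%:R / (m %/ h)%:R) * ((a == d) && (b == c))%:R.
Proof.
have R0 : R 0 = 0 by apply: (addIr (R 0)); rewrite -RD !add0r.
have Rsum (I : finType) G : R (\sum_(i : I) G i) = \sum_i R (G i).
  exact: (big_morph R RD R0).
pose G a b c d := \sum_j R (tw_basis j) a b * R (tw_dual j) c d.
pose a0 := Ordinal m_gt0.
have deltaE (X Y : 'M[F]_m) a b c d :
    (X *m delta_mx b c *m Y) a d = X a b * Y c d.
  rewrite mxE (bigD1 c) //= mxE (bigD1 b) //= !mxE !eqxx mulr1.
  rewrite [X in _ + X]big1 => [|i ic]; last first.
    rewrite mxE big1 ?mul0r // => k _.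
    by rewrite !mxE (negPf ic) andbF mulr0.
  rewrite addr0 big1 ?addr0 // => k kb.
  by rewrite !mxE (negPf kb) mulr0.
(* Averaging the matrix unit (b, c) along the Casimir tensor gives a matrix commuting with R, hence
   a scalar. [G2] does the same with the tensor factors exchanged. *)
have G1 b c : exists k, forall a d, G a b c d = k * (a == d)%:R.
  pose B x z := R x *m delta_mx b c *m R z.
  have [a|k kE] := R_irr (C := \sum_j B (tw_basis j) (tw_dual j)).
    rewrite mulmx_suml mulmx_sumr.
    transitivity (\sum_j B (tw_basis j) (tw_dual j * a)).
      by apply: eq_bigr => j _; rewrite /B RM !mulmxA.
    rewrite -casimir_swap_out => [|z x x'|x z z'|k x z].
    - by apply: eq_bigr => j _; rewrite /B RM !mulmxA.
    - by rewrite /B RD !mulmxDl.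
    - by rewrite /B RD !mulmxDr.
    - by rewrite /B !RZ -!scalemxAl -scalemxAr.
  exists k => a d; move/matrixP/(_ a d): kE; rewrite mulr_natr summxE mxE => <-.
  by apply: eq_bigr => j _; rewrite /B deltaE.
have G2 d a : exists k, forall c b, G a b c d = k * (c == b)%:R.
  pose B x z := R z *m delta_mx d a *m R x.
  have [e|k kE] := R_irr (C := \sum_j B (tw_basis j) (tw_dual j)).
    rewrite mulmx_suml mulmx_sumr.
    transitivity (\sum_j B (tw_basis j * e) (tw_dual j)).
      by apply: eq_bigr => j _; rewrite /B RM !mulmxA.
    rewrite casimir_swap_in => [|z x x'|x z z'|k x z].
    - by apply: eq_bigr => j _; rewrite /B RM !mulmxA.
    - by rewrite /B RD !mulmxDr.
    - by rewrite /B RD !mulmxDl.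
    - by rewrite /B !RZ -!scalemxAl -scalemxAr.
  exists k => c b; move/matrixP/(_ c b): kE; rewrite mulr_natr summxE mxE => <-.
  by apply: eq_bigr => j _; rewrite /B deltaE mulrC.
have [k GE] : exists k, forall a b c d,
    G a b c d = k * ((a == d) && (b == c))%:R.
  have [k kE] := G2 a0 a0; exists k => a b c d.
  have [k' k'E] := G1 b c; have := k'E a0 a0; rewrite kE eqxx mulr1 => kk'.
  by rewrite k'E -kk' -mulrA -natrM mulnb andbC eq_sym [c == b]eq_sym.
have [z z1] := alg_trace_neq0 y_ys.
(* An entry of the image of the Casimir sum for an element z of trace 1, computed in two ways. *)
have kr : k * (m %/ h)%:R = phi #|N|%:R.
  have /matrixP/(_ a0 a0) := congr1 R (casimir_sum z).
  rewrite Rsum z1 RZ R1 !mxE eqxx mulr1 summxE => <-.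
  transitivity (k * \tr (R (tw to 1%g z))).
    by rewrite representation_trace_nat z1 rmorph1 mul1r.
  transitivity (\sum_b \sum_c R (tw to 1%g z) b c * G a0 b c a0).
    rewrite mulr_sumr; apply: eq_bigr => b _; rewrite (bigD1 b) //= GE !eqxx.
    rewrite big1 ?addr0 ?mulr1 1?mulrC // => c cb.
    by rewrite GE eqxx eq_sym (negPf cb) mulr0 mulr0.
  under eq_bigr => b _ do under eq_bigr => c _ do rewrite mulr_sumr.
  under eq_bigr => b _ do rewrite exchange_big.
  rewrite exchange_big /=; apply: eq_bigr => j _.
  rewrite RM RM [RHS]mxE exchange_big /=; apply: eq_bigr => c _.
  rewrite [X in _ = X * _]mxE mulr_suml; apply: eq_bigr => b _.
  by rewrite mulrCA mulrA.
have r_neq0 : (m %/ h)%:R != 0 :> K.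
  apply: contra_neq N_neq0 => r0; apply: (fmorph_inj phi).
  by rewrite -kr -(rmorph_nat phi) r0 rmorph0 mulr0.
move=> a b c d; rewrite -/(G a b c d) GE; congr (_ * _).
by rewrite fmorph_div -kr rmorph_nat mulfK // -(rmorph_nat phi) fmorph_eq0.
Qed.

End Casimir.

(** * Modules and density *)

Section Modules.
Variables (K : fieldType) (A : falgType K).

HB.instance Definition _ (M : rmodule A) (x : M) :=
  GRing.isSemilinear.Build K A M _ (@ract K A M x)
    (GRing.semilinear_linear (ract_linearr x)).

Lemma ractDl (M : rmodule A) (a : A) : {morph (@ract K A M)^~ a : x y / x + y}.
Proof. exact: (raddfD (@ract_by K A M a)). Qed.

Lemma ract_suml (M : rmodule A) (a : A) (I : finType) (F : I -> M) :
  ract (\sum_i F i) a = \sum_i ract (F i) a.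
Proof. exact: (raddf_sum (@ract_by K A M a)). Qed.

Lemma ractZl (M : rmodule A) (a : A) k (x : M) :
  ract (k *: x) a = k *: ract x a.
Proof. exact: (linearZ_LR (@ract_by K A M a)). Qed.

Lemma ractDr (M : rmodule A) (x : M) : {morph ract x : a b / a + b}.
Proof. exact: (raddfD (@ract K A M x)). Qed.

Lemma ractBr (M : rmodule A) (x : M) : {morph ract x : a b / a - b}.
Proof. exact: (raddfB (@ract K A M x)). Qed.

Lemma ract_sumr (M : rmodule A) (x : M) (I : finType) (F : I -> A) :
  ract x (\sum_i F i) = \sum_i ract x (F i).
Proof. exact: (raddf_sum (@ract K A M x)). Qed.

Lemma ractZr (M : rmodule A) (x : M) k (a : A) :
  ract x (k *: a) = k *: ract x a.
Proof. exact: (linearZ_LR (@ract K A M x)). Qed.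

Lemma ract0l (M : rmodule A) (a : A) : ract (0 : M) a = 0.
Proof. exact: (raddf0 (@ract_by K A M a)). Qed.

Lemma schur_bij (M M' : smodule A) (f : 'Hom(M, M')) :
  (forall x a, f (ract x a) = ract (f x) a) -> f != 0 ->
  lker f = 0%VS /\ limg f = fullv.
Proof.
move=> fA f0; split.
  have [_ /(_ (lker f))[x a|//|kerf]] := smP M.
    by rewrite !memv_ker fA => /eqP->; rewrite ract0l.
  case/eqP: f0; apply/lfunP=> x; rewrite lfunE; apply/eqP.
  by rewrite -memv_ker kerf memvf.
have [_ /(_ (limg f))[x a|imgf|//]] := smP M'.
  by case/memv_imgP=> z _ ->; rewrite -fA memv_img ?memvf.
case/eqP: f0; apply/lfunP=> x; rewrite lfunE; apply/eqP.
by rewrite -memv0 -imgf memv_img ?memvf.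
Qed.

Lemma schur_hom (M M' : smodule A) (f : 'Hom(M, M')) :
  (forall x a, f (ract x a) = ract (f x) a) -> f != 0 -> rm_isomorphic M M'.
Proof.
move=> fA f0; have [kf gf] := schur_bij fA f0.
exists f; split=> //; exists (f^-1)%VF => x.
  by rewrite -[RHS](lker0_lfunK (introT eqP kf)).
by apply: limg_lfunVK; rewrite gf memvf.
Qed.

(** * Density and the matrix operation *)

Section Density.
Variable M : smodule A.
Local Notation D := (endo M).

Lemma endo_appDl (f g : D) x : endo_app (f + g) x = endo_app f x + endo_app g x.
Proof. by rewrite /endo_app /= add_lfunE. Qed.

Lemma endo_appZl k (f : D) x : endo_app (k *: f) x = k *: endo_app f x.
Proof. by rewrite /endo_app /= scale_lfunE. Qed.

Lemma endo_app_suml (I : finType) (F : I -> D) x :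
  endo_app (\sum_i F i) x = \sum_i endo_app (F i) x.
Proof.
apply: (big_morph (fun f : D => endo_app f x)) => [f g|].
  exact: endo_appDl.
by rewrite /endo_app /= lfunE.
Qed.

Lemma endo_app_sumr (f : D) (I : finType) (F : I -> M) :
  endo_app f (\sum_i F i) = \sum_i endo_app f (F i).
Proof. exact: linear_sum. Qed.

Lemma endo_inv (f : D) : f != 0 -> exists g : D, g * f = 1.
Proof.
move=> f0; have f0' : vsval f != 0.
  by apply: contra_neq f0 => f0; apply: val_inj.
have fA := endo_spaceP _ (subvsP f).
have [/eqP kf gf] := schur_bij fA f0'.
have ginA : ((vsval f)^-1)%VF \in endo_space M.
  apply/endo_spaceP => x a; have [z ->] : exists z, x = vsval f z.
    by exists ((vsval f)^-1%VF x); rewrite limg_lfunVK // gf memvf.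
  by rewrite -fA !lker0_lfunK.
exists (Subvs ginA); apply: val_inj; apply/lfunP=> x /=.
by rewrite comp_lfunE lker0_lfunK // id_lfunE.
Qed.

Variables (n : nat) (e : 'I_n -> M).
Hypothesis e_basis : endo_basis e.

Lemma endo_coordP (c c' : 'I_n -> D) :
  \sum_b endo_app (c b) (e b) = \sum_b endo_app (c' b) (e b) -> c =1 c'.
Proof.
move=> cc' b; have [r [_ r_uniq]] := e_basis (\sum_b endo_app (c b) (e b)).
have rE (c0 : 'I_n -> D) :
    \sum_b endo_app (c b) (e b) = \sum_b endo_app (c0 b) (e b) ->
    r = \row_b c0 b.
  by move=> H; apply: r_uniq; rewrite H; apply: eq_bigr => i _; rewrite mxE.
by have := rE c' cc'; rewrite (rE c) // => /rowP/(_ b); rewrite !mxE.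
Qed.

Lemma endo_coord_exists :
  exists c : 'I_n -> M -> D, forall x, x = \sum_b endo_app (c b x) (e b).
Proof.
have cP x : exists c : 'rV[D]_n, x == \sum_b endo_app (c 0 b) (e b).
  by have [c [/eqP cE _]] := e_basis x; exists c.
by exists (fun b x => xchoose (cP x) 0 b) => x; apply/eqP/(xchooseP (cP x)).
Qed.

(** Jacobson density, by induction on the number k of basis vectors whose images are prescribed. The
    annihilator [Ik] of the first k maps the next vector [ek] onto a submodule [U]. If [U] is
    everything, an element of [Ik] corrects the image of [ek]. *)
Lemma density (t : 'I_n -> M) : exists a, forall i, ract (e i) a = t i.
Proof.
suff /(_ n (leqnn n) t)[a aE] : forall k, (k <= n)%N -> forall t : 'I_n -> M,
    exists a, forall i : 'I_n, (i < k)%N -> ract (e i) a = t i.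
  by exists a => i; apply: aE.
elim=> [|k IHk] kn {}t; first by exists 0.
have {}IHk := IHk (ltnW kn); pose ek := Ordinal kn.
pose Ik := (\bigcap_(i < n | (i < k)%N) lker (linfun (ract (e i))))%VS.
have IkP a :
    reflect (forall i : 'I_n, (i < k)%N -> ract (e i) a = 0) (a \in Ik).
  rewrite memvE; apply: (iffP subv_bigcapP) => aI i ik.
    by have := aI i ik; rewrite -memvE memv_ker lfunE => /eqP.
  by rewrite -memvE memv_ker lfunE /= aI.
pose U := (linfun (ract (e ek)) @: Ik)%VS.
have subU : submodule U.
  move=> x a /memv_imgP[b /IkP bI ->]; rewrite lfunE /= -ractM.
  apply/memv_imgP; exists (b * a); last by rewrite lfunE.
  by apply/IkP => i ik; rewrite ractM bI // ract0l.
have [_ /(_ U subU)[U0|UT]] := smP M; last first.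
  have [a aE] := IHk t.
  have /memv_imgP[b /IkP bI bE] : t ek - ract (e ek) a \in U.
    by rewrite UT memvf.
  exists (a + b) => i; rewrite ltnS leq_eqVlt ractDr => /predU1P[ik|ik].
    have -> : i = ek by apply: val_inj.
    by rewrite lfunE /= in bE; rewrite -bE addrC subrK.
  by rewrite aE // bI // addr0.
(* If [U] is 0, the action on the first k vectors determines that on [ek]. Then sending v to the
   image of [ek] under an element taking [e l] to v and the other early vectors to 0 is an
   endomorphism [f l], and [ek] is the sum of the [f b (e b)], against independence. *)
have Ik0 a : (forall i : 'I_n, (i < k)%N -> ract (e i) a = 0) ->
    ract (e ek) a = 0.
  move=> /IkP aI; apply/eqP; rewrite -memv0 -U0.
  by apply/memv_imgP; exists a; rewrite ?lfunE.
have sP l v : exists a, [forall i : 'I_n, (i < k)%N ==>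
    (ract (e i) a == if i == l then v else 0)].
  have [a aE] := IHk (fun i => if i == l then v else 0).
  by exists a; apply/forallP => i; apply/implyP => /aE->.
pose s l v := xchoose (sP l v).
have sE l v (i : 'I_n) : (i < k)%N ->
    ract (e i) (s l v) = if i == l then v else 0.
  by move=> ik; have /forallP/(_ i)/implyP/(_ ik)/eqP := xchooseP (sP l v).
pose f l v := ract (e ek) (s l v).
have f_lin l : linear (f l).
  move=> c u v; apply/eqP; rewrite /f -ractZr -ractDr -subr_eq0 -ractBr.
  rewrite Ik0 // => i ik; rewrite ractBr ractDr ractZr !sE //.
  by case: eqP => _; rewrite ?scaler0 ?addr0 subrr.
pose fL l : {linear M -> M} := HB.pack (f l)
  (GRing.isSemilinear.Build K M M _ (f l) (GRing.semilinear_linear (f_lin l))).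
have fA l : linfun (fL l) \in endo_space M.
  apply/endo_spaceP => x a; rewrite !lfunE /= /f -ractM; apply/eqP.
  rewrite -subr_eq0 -ractBr Ik0 // => i ik; rewrite ractBr ractM !sE //.
  by case: eqP => _; rewrite ?ract0l subrr.
pose c1 b : D := if b == ek then 1 else 0.
pose c2 (b : 'I_n) : D := if (b < k)%N then Subvs (fA b) else 0.
have app0 x : endo_app (0 : D) x = 0 by rewrite /endo_app /= lfunE.
have /endo_coordP/(_ ek) :
    \sum_b endo_app (c1 b) (e b) = \sum_b endo_app (c2 b) (e b).
  rewrite (bigD1 ek) //= big1 => [|b /negPf bek]; last by rewrite /c1 bek app0.
  rewrite /c1 eqxx addr0 {1}/endo_app /= id_lfunE.
  pose a := \sum_(b : 'I_n) if (b < k)%N then s b (e b) else 0.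
  have /eqP : ract (e ek) (1 - a) = 0.
    apply: Ik0 => i ik; rewrite ractBr ract1 ract_sumr (bigD1 i) //= ik sE //.
    rewrite eqxx big1 ?addr0 ?subrr // => j ji.
    by case: ifP => _; rewrite ?raddf0 // sE // eq_sym (negPf ji).
  rewrite ractBr ract1 subr_eq0 => /eqP->; rewrite ract_sumr.
  apply: eq_bigr => b _; rewrite /c2; case: (b < k)%N.
    exact: (esym (lfunE (fL b) (e b))).
  by rewrite app0 raddf0.
by rewrite /c1 /c2 eqxx /= ltnn => /eqP; rewrite oner_eq0.
Qed.

Variable om : A -> 'M[D]_n.
Hypothesis omE : matrix_operation e om.

Lemma om_eq a (B : 'M[D]_n) :
  (forall i, ract (e i) a = \sum_j endo_app (B i j) (e j)) -> om a = B.
Proof.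
move=> aE; apply/matrixP=> i; apply: endo_coordP.
by rewrite -aE -omE.
Qed.

Lemma om_surj (B : 'M[D]_n) : exists a, om a = B.
Proof.
have [a aE] := density (fun i => \sum_j endo_app (B i j) (e j)).
by exists a; apply: om_eq.
Qed.

Lemma omD : {morph om : a b / a + b}.
Proof.
move=> a b; apply: om_eq => i; rewrite ractDr !omE -big_split /=.
by apply: eq_bigr => j _; rewrite mxE endo_appDl.
Qed.

Lemma omZ k a i j : om (k *: a) i j = k *: om a i j.
Proof.
rewrite (@om_eq _ (\matrix_(i, j) (k *: om a i j))) ?mxE // => {}i.
rewrite ractZr omE scaler_sumr; apply: eq_bigr => l _.
by rewrite mxE endo_appZl.
Qed.

Lemma om1 : om 1 = 1%:M.
Proof.
apply: om_eq => i; rewrite ract1 (bigD1 i) //= mxE eqxx big1 => [|j /negPf ji].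
  by rewrite /endo_app /= id_lfunE addr0.
by rewrite mxE eq_sym ji /endo_app /= lfunE.
Qed.

(** Endomorphisms act from the left and commute with the right action, so the matrices multiply in
    the order of the elements. *)
Lemma omM a b : om (a * b) = om a *m om b.
Proof.
apply: om_eq => i; rewrite ractM omE ract_suml.
under eq_bigr => j _ do rewrite -endo_appP omE endo_app_sumr.
rewrite exchange_big /=; apply: eq_bigr => l _; rewrite mxE endo_app_suml.
by apply: eq_bigr => j _; rewrite endo_appM.
Qed.

End Density.
End Modules.

(** * Schur relations *)

Lemma vsval_alg (K : fieldType) (D : falgType K) (k : K) :
  vsval (k%:A : center D) = k%:A.
Proof.
rewrite linearZ /= algid_center; congr (_ *: _).
by apply/eqP; rewrite algid_eq1 memvf.
Qed.

(** * Reduced traces through a splitting *)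

Section SplittingTrace.
Variables (K : fieldType) (D : falgType K).
Hypothesis D_inv : forall u : D, u != 0 -> exists v, v * u = 1.
Variables (d : nat) (F : fieldType) (phi : {rmorphism center D -> F}).
Variable rho : {rmorphism D -> 'M[F]_d}.
Hypothesis d_gt0 : (0 < d)%N.
Hypothesis rho_center : forall z : center D, rho (vsval z) = (phi z)%:M.
Variable t : D -> center D.
Hypothesis tE : forall u, phi (t u) = \tr (rho u).

Lemma splitting_inj : injective rho.
Proof.
apply: raddf_inj => u rho0; apply/eqP/negPn/negP => /D_inv[v uv].
have /matrixP/(_ (Ordinal d_gt0) (Ordinal d_gt0)) := rmorph1 rho.
rewrite -uv rmorphM rho0 mulr0 !mxE eqxx => /esym/eqP.
by rewrite oner_eq0.
Qed.

Lemma splitting_center_inj : injective phi.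
Proof.
apply: raddf_inj => z phi0; apply: val_inj; apply: splitting_inj.
by rewrite !rho_center phi0 !rmorph0.
Qed.

Lemma splitting_centerM z u : rho (vsval z * u) = phi z *: rho u.
Proof. by rewrite rmorphM /= rho_center -mul_scalar_mx. Qed.

Lemma splittingZ k u : rho (k *: u) = phi k%:A *: rho u.
Proof. by rewrite -[k *: u]mulr_algl -vsval_alg splitting_centerM. Qed.

Lemma trdD : {morph t : u v / u + v}.
Proof.
move=> u v; apply: splitting_center_inj.
by rewrite tE !rmorphD /= !tE mxtraceD.
Qed.

Lemma trd_mul u (z : center D) : t (u * vsval z) = t u * z.
Proof.
apply: splitting_center_inj; rewrite tE !rmorphM /= rho_center tE.
by rewrite -[X in \tr X]/(rho u *m _) mul_mx_scalar mxtraceZ mulrC.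
Qed.

Lemma trdZ k u : t (k *: u) = k *: t u.
Proof.
rewrite -[k *: u]mulr_algr -vsval_alg trd_mul.
by rewrite -scalerAr mulr1.
Qed.

End SplittingTrace.

Section DualBases.
Variables (K : fieldType) (L : fieldExtType K).
Variables (y ys : (\dim {:L}).-tuple L).
Hypothesis y_basis : basis_of {:L} y.
Hypothesis ys_dual :
  forall l m, alg_trace (tnth y l * tnth ys m) = (l == m)%:R.

Lemma trace_basis_expand z :
  z = \sum_l alg_trace (z * tnth ys l) *: tnth y l.
Proof.
rewrite {1}(coord_basis y_basis (memvf z)); apply: eq_bigr => l _.
rewrite -tnth_nth; congr (_ *: _).
rewrite {2}(coord_basis y_basis (memvf z)) mulr_suml alg_trace_sum.
rewrite (bigD1 l) //= -tnth_nth -scalerAl alg_traceZ ys_dual eqxx mulr1.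
rewrite big1 ?addr0 // => m /negPf ml.
by rewrite -tnth_nth -scalerAl alg_traceZ ys_dual ml mulr0.
Qed.

Lemma trace_dual_expand z :
  z = \sum_l alg_trace (z * tnth y l) *: tnth ys l.
Proof.
apply/eqP; rewrite -subr_eq0; apply/eqP.
apply: (alg_trace_nondeg trace_basis_expand) => u.
rewrite [u]trace_basis_expand mulr_suml alg_trace_sum big1 // => l _.
rewrite -scalerAl alg_traceZ mulrBr alg_traceB mulr_sumr alg_trace_sum.
rewrite (bigD1 l) //= -scalerAr alg_traceZ ys_dual eqxx mulr1.
rewrite big1 => [|m ml]; last first.
  by rewrite -scalerAr alg_traceZ ys_dual eq_sym (negPf ml) mulr0.
by rewrite addr0 [z * _]mulrC subrr mulr0.
Qed.

End DualBases.

Section Schur.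
Variables (gT : finGroupType) (K : fieldType) (L : fieldExtType K).
Variables (to : field_action L gT).
Variables (N : {set gT}).
Hypothesis kerN : forall s, s \in N <-> (forall y, to y s = y).
Hypothesis N_neq0 : #|N|%:R != 0 :> K.
Local Notation h := (\dim {:L}).
Variables (y ys : 'I_h -> L).
Hypothesis y_dual : forall l m, alg_trace (y l * ys m) = (l == m)%:R.
Hypothesis y_ys : forall z, z = \sum_l alg_trace (z * ys l) *: y l.
Hypothesis ys_y : forall z, z = \sum_l alg_trace (z * y l) *: ys l.
Local Notation A := (twring to).
Local Notation u := (tw_basis to y).
Local Notation v := (tw_dual to ys).

(** Averaging a K-linear map of rank at most one from M to M' along the Casimir tensor gives a
    module homomorphism, which vanishes by Schur's lemma; its coordinates are the sums in
    question. *)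
Lemma schur_orthogonal (M M' : smodule A) n n'
    (e : 'I_n -> M) (e' : 'I_n' -> M')
    (om : A -> 'M[endo M]_n) (om' : A -> 'M[endo M']_n')
    (tau : endo M' -> K) a b a' b' :
    linear (tau : endo M' -> K^o) ->
    endo_basis e -> endo_basis e' ->
    matrix_operation e om -> matrix_operation e' om' ->
    ~ rm_isomorphic M M' ->
  \sum_j tau (om' (v j) b' a') *: om (u j) a b = 0.
Proof.
move=> tau_lin eP e'P omE om'E nMM'.
pose tauL : {linear endo M' -> K^o} := HB.pack tau
  (GRing.isSemilinear.Build K (endo M') K^o _ tau
    (GRing.semilinear_linear tau_lin)).
have [c cE] := endo_coord_exists eP.
have c_uniq z (r : 'I_n -> endo M) :
    z = \sum_b endo_app (r b) (e b) -> forall b, c b z = r b.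
  by move=> zE; apply: (endo_coordP eP); rewrite -cE.
have cP b0 k : {morph c b0 : z w / k *: z + w >-> k *: z + w}.
  move=> z w; apply: (c_uniq _ (fun b => k *: c b z + c b w)).
  rewrite {1}[z]cE {1}[w]cE scaler_sumr -big_split; apply: eq_bigr => l _.
  by rewrite endo_appDl endo_appZl.
(* It suffices to replace the coefficient in [endo M] by its value under a functional [mu]: with
   [mu] a coordinate, [tau] of the relation is that coordinate of the claim. *)
suff muS (mu : {linear endo M -> K^o}) :
    \sum_j (mu (om (u j) a b) : K) *: om' (v j) b' a' = 0.
  set S := \sum_j _; rewrite [S](coord_vbasis (memvf S)) big1 // => q _.
  have := congr1 tauL (muS (coord (vbasis {:endo M}) q)).
  rewrite linear0 raddf_sum /= => S0.
  rewrite raddf_sum /= (_ : \sum_j _ = 0) ?scale0r // -[RHS]S0.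
  apply: eq_bigr => j _; rewrite linearZ_LR /= [LHS]mulrC.
  exact: esym (linearZ_LR tauL _ _).
pose f z := (mu (c b z) : K) *: e' b'.
have f_lin : linear f.
  by move=> k z w; rewrite /f cP linearP /= scalerDl scalerA.
have fD : {morph f : z w / z + w}.
  by move=> z w; rewrite -[z]scale1r f_lin !scale1r.
have f0 : f 0 = 0 by apply: (addIr (f 0)); rewrite -fD !add0r.
have fZ k z : f (k *: z) = k *: f z by rewrite -[k *: z]addr0 f_lin f0 addr0.
pose G z := \sum_j ract (f (ract z (u j))) (v j).
have G_lin : linear G.
  move=> k z w; rewrite /G scaler_sumr -big_split; apply: eq_bigr => j _ /=.
  by rewrite -ractZl -ractDl -fZ -fD -ractZl -ractDl.
pose GL : {linear M -> M'} := HB.pack G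
  (GRing.isSemilinear.Build K M M' _ G (GRing.semilinear_linear G_lin)).
have GA z x : linfun GL (ract z x) = ract (linfun GL z) x.
  rewrite !lfunE /= /G ract_suml.
  pose B p q := ract (f (ract z p)) q.
  transitivity (\sum_j B (x * u j) (v j)).
    by apply: eq_bigr => j _; rewrite /B ractM.
  rewrite casimir_swap_out // => [|q p p'|p q q'|k p q].
  - by apply: eq_bigr => j _; rewrite /B ractM.
  - by rewrite /B ractDr fD ractDl.
  - by rewrite /B ractDr.
  - by rewrite /B !ractZr fZ ractZl.
have G0 : linfun GL = 0.
  by apply/eqP/negPn/negP => G0; apply: nMM'; apply: schur_hom GA G0.
have Ga : G (e a) = 0 by have := lfunE GL (e a); rewrite G0 lfunE.
apply: (endo_coordP e'P (c' := fun=> 0) (c := fun a' =>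
  \sum_j (mu (om (u j) a b) : K) *: om' (v j) b' a')).
under [RHS]eq_bigr => l _ do rewrite /endo_app /= lfunE.
rewrite [RHS]big1 // -[RHS]Ga /G.
under [RHS]eq_bigr => j _ do
  rewrite /f (c_uniq _ _ (omE (u j) a)) ractZl om'E scaler_sumr.
rewrite [RHS]exchange_big /=; apply: eq_bigr => l _.
by rewrite endo_app_suml; apply: eq_bigr => j _; rewrite endo_appZl.
Qed.

Section Diagonal.
Variables (M : smodule A) (n : nat) (e : 'I_n -> M).
Local Notation D := (endo M).
Variable om : A -> 'M[D]_n.
Hypothesis eP : endo_basis e.
Hypothesis omE : matrix_operation e om.
Variables (d : nat) (F : fieldType) (phi : {rmorphism center D -> F}).
Variable rho : {rmorphism D -> 'M[F]_d}.
Hypothesis d_gt0 : (0 < d)%N.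
Hypothesis rhoP : splitting phi rho.

(** Each entry over the skew field is blown up to a d x d block by [rho]; pairs (block, place in the
    block) index the rows and columns. *)
Definition split_rep (x : A) : 'M[F]_#|{: 'I_n * 'I_d}| :=
  \matrix_(i, j) rho (om x (enum_val i).1 (enum_val j).1)
                     (enum_val i).2 (enum_val j).2.

Lemma split_repE x (i j : 'I_n * 'I_d) :
  split_rep x (enum_rank i) (enum_rank j) = rho (om x i.1 j.1) i.2 j.2.
Proof. by rewrite mxE !enum_rankK. Qed.

Lemma split_repM a b : split_rep (a * b) = split_rep a *m split_rep b.
Proof.
apply/matrixP=> i j; rewrite !mxE (omM eP omE) mxE rmorph_sum summxE /=.
rewrite (reindex_onto enum_rank enum_val) /= => [|k _]; last exact: enum_valK.
transitivity (\sum_(k : 'I_n * 'I_d)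
  split_rep a i (enum_rank k) * split_rep b (enum_rank k) j).
  under eq_bigr => p _ do rewrite rmorphM mxE.
  by rewrite pair_bigA; apply: eq_bigr => k _; rewrite !mxE !enum_rankK.
by apply: eq_bigl => k; rewrite enum_rankK eqxx.
Qed.

Lemma split_repD : {morph split_rep : a b / a + b}.
Proof.
by move=> a b; apply/matrixP=> i j; rewrite !mxE (omD eP omE) mxE rmorphD mxE.
Qed.

Lemma split_rep1 : split_rep 1 = 1%:M.
Proof.
apply/matrixP=> i j; rewrite !mxE (om1 eP omE) mxE.
rewrite -[i in RHS]enum_valK -[j in RHS]enum_valK (inj_eq enum_rank_inj).
case: (enum_val i) (enum_val j) => [p q] [p' q'] /=; rewrite xpair_eqE.
by case: eqP => _; rewrite ?rmorph1 ?rmorph0 mxE.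
Qed.

Lemma split_repZ k a : split_rep (k *: a) = phi k%:A *: split_rep a.
Proof.
have [_ rho_center _] := rhoP.
apply/matrixP=> i j; rewrite !mxE (omZ eP omE) (splittingZ rho_center).
by rewrite mxE.
Qed.

(** The image spans all matrices over F: density realises every matrix over the skew field, and
    [rho] of a K-basis spans each block. So C commutes with all matrix units. *)
Lemma split_rep_irr C :
  (forall a, C *m split_rep a = split_rep a *m C) -> exists c, C = c%:M.
Proof.
have [_ _ rho_span] := rhoP; move=> CR.
have Cdelta i j : C *m delta_mx i j = delta_mx i j *m C.
  have [c cE] := rho_span (delta_mx (enum_val i).2 (enum_val j).2).
  suff [w wE] : exists w : 'I_(\dim {:D}) -> A,
      delta_mx i j = \sum_k c k *: split_rep (w k).
    rewrite wE mulmx_sumr mulmx_suml; apply: eq_bigr => k _.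
    by rewrite -scalemxAr -scalemxAl CR.
  have omP k : exists x, om x ==
      (delta_mx (enum_val i).1 (enum_val j).1 *m ((vbasis {:D})`_k)%:M).
    have [x xE] := om_surj eP omE
      (delta_mx (enum_val i).1 (enum_val j).1 *m ((vbasis {:D})`_k)%:M).
    by exists x; apply/eqP.
  exists (fun k : 'I_(\dim {:D}) => xchoose (omP k)).
  apply/matrixP=> i' j'; rewrite summxE.
  have -> : delta_mx i j i' j' = ((enum_val i').1 == (enum_val i).1)%:R *
      ((enum_val j').1 == (enum_val j).1)%:R *
      (delta_mx (enum_val i).2 (enum_val j).2 : 'M[F]_d)
        (enum_val i').2 (enum_val j').2.
    rewrite !mxE -!natrM !mulnb.
    rewrite -(inj_eq enum_val_inj) -[j' == j](inj_eq enum_val_inj).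
    case: (enum_val i) (enum_val i') => [p q] [p' q'].
    case: (enum_val j) (enum_val j') => [r s] [r' s']; rewrite !xpair_eqE /=.
    by do 4!case: eqP => _.
  rewrite cE summxE mulr_sumr; apply: eq_bigr => k _.
  rewrite !mxE (eqP (xchooseP (omP k))) mxE.
  rewrite (bigD1 (enum_val j).1) //= big1 => [|l lj]; last first.
    by rewrite !mxE (negPf lj) andbF mul0r.
  rewrite !mxE addr0 eqxx andbT [(enum_val j).1 == _]eq_sym.
  by do 2!case: eqP => _;
    rewrite ?(mulr1n, mulr0n, mul0r, mul1r) ?rmorph0 ?[in RHS]mxE ?mulr0.
(* Reading off the scalar takes an index, so empty matrices come separately. *)
have [m0|m0] := posnP #|{: 'I_n * 'I_d}|.
  by exists 0; apply/matrixP => i; have := ltn_ord i; rewrite {2}m0.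
pose i0 := Ordinal m0; exists (C i0 i0); apply/matrixP=> i j; rewrite !mxE.
have /matrixP/(_ i i0) := Cdelta j i0; rewrite !mxE.
rewrite (bigD1 j) //= big1 => [|k kj]; last by rewrite mxE (negPf kj) mulr0.
rewrite mxE !eqxx addr0 mulr1 => ->.
rewrite (bigD1 i0) //= big1 => [|k kj]; last first.
  by rewrite mxE (negPf kj) andbF mul0r.
by rewrite mxE eqxx andbT addr0 mulr_natl.
Qed.

Variable t : D -> center D.
Hypothesis tE : forall z, phi (t z) = \tr (rho z).

Lemma schur_diagonal a b a' b' :
  \sum_j alg_trace (t (om (v j) b' a')) *: om (u j) a b =
    ((#|N|%:R / ((n * d) %/ h)%:R) *+ ((a == a') && (b == b')))%:A.
Proof.
have [_ rho_center _] := rhoP.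
have D_inv := @endo_inv _ _ M.
have tM := trd_mul D_inv d_gt0 rho_center tE.
have tZ := trdZ D_inv d_gt0 rho_center tE.
have tD := trdD D_inv d_gt0 rho_center tE.
pose vb := vbasis {:center D}.
(* Expanding the trace of w in center D as the sum over s of the s-th coordinate
   of w vb_s, the factor vb_s moves from v to u across the Casimir tensor. *)
have -> : \sum_j alg_trace (t (om (v j) b' a')) *: om (u j) a b =
    \sum_j vsval (t (om (v j) b' a')) * om (u j) a b.
  under eq_bigr => j _ do rewrite alg_traceE scaler_suml.
  under [RHS]eq_bigr => j _ do
    rewrite (coord_vbasis (memvf (t (om (v j) b' a')))) linear_sum mulr_suml.
  rewrite exchange_big [RHS]exchange_big /=; apply: eq_bigr => s _.
  (* By density some x acts as the scalar matrix of the central element [vb_s]. *)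
  have [x xE] := om_surj eP omE (vsval vb`_s)%:M.
  pose B p q := (coord vb s (t (om q b' a')) : K) *: om p a b.
  transitivity (\sum_j B (u j) (v j * x)).
    apply: eq_bigr => j _; rewrite /B (omM eP omE _ x) xE mxE (bigD1 a') //=.
    rewrite big1 => [|k ka]; last by rewrite mxE (negPf ka) mulr0.
    by rewrite addr0 mxE eqxx mulr1n tM.
  rewrite -casimir_swap_out // => [|q p p'|p q q'|k p q].
  - apply: eq_bigr => j _; rewrite /B (omM eP omE x) xE mxE (bigD1 a) //=.
    rewrite big1 => [|k ka]; last by rewrite mxE eq_sym (negPf ka) mul0r.
    by rewrite addr0 mxE eqxx mulr1n scalerAl.
  - by rewrite /B (omD eP omE) mxE scalerDr.
  - by rewrite /B (omD eP omE) mxE tD linearD scalerDl.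
  - by rewrite /B !(omZ eP omE) tZ (linearZ_LR (coord vb s)) /= !scalerA mulrC.
apply: (splitting_inj D_inv (rho := rho) d_gt0).
have m_gt0 : (0 < #|{: 'I_n * 'I_d}|)%N.
  by apply/card_gt0P; exists (a, Ordinal d_gt0).
pose phi0 : {rmorphism K -> F} := phi \o in_alg (center D).
have schurE := @representation_schur _ _ _ to y ys y_dual y_ys ys_y N
  kerN N_neq0 F phi0 _ split_rep m_gt0 split_repD split_repM split_rep1
  split_repZ split_rep_irr.
have <- : #|{: 'I_n * 'I_d}| = (n * d)%N by rewrite card_prod !card_ord.
apply/matrixP=> p q; rewrite rmorph_sum summxE /=.
(* The reduced trace becomes the sum over r of diagonal entries of the block (b', a'). Each r is one
   Schur relation of [split_rep], and only r = p survives. *)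
transitivity (\sum_r \sum_j
   split_rep (u j) (enum_rank (a, p)) (enum_rank (b, q))
   * split_rep (v j) (enum_rank (b', r)) (enum_rank (a', r))).
  rewrite exchange_big /=; apply: eq_bigr => j _.
  rewrite (splitting_centerM rho_center) tE mxE mulr_suml.
  by apply: eq_bigr => r _; rewrite !split_repE mulrC.
under eq_bigr => r _ do rewrite schurE !(inj_eq enum_rank_inj) !xpair_eqE.
have phiE k (c : bool) : phi (k *+ c)%:A = phi0 k * c%:R.
  by case: c; rewrite ?mulr1 // scale0r rmorph0 mulr0.
rewrite (splittingZ rho_center) rmorph1 !mxE phiE (bigD1 p) //=.
rewrite big1 => [|r rp].
  rewrite eqxx addr0 !andbT -mulrA -natrM mulnb; congr (_ * (nat_of_bool _)%:R).
  by rewrite andbA [q == p]eq_sym.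
by rewrite [p == r]eq_sym (negPf rp) andbF mulr0.
Qed.

End Diagonal.
End Schur.

Theorem corollary1p19
    (gT : finGroupType) (K : fieldType) (L : fieldExtType K)
    (to : field_action L gT)
    (N : {set gT})
    (kerN : forall s, s \in N <-> (forall y, to y s = y))
    (n_inv : (#|N|%:R : K) \is a GRing.unit)
    (y ys : (\dim {:L}).-tuple L)
    (y_basis : basis_of {:L} y)
    (ys_dual : forall l m, alg_trace (tnth y l * tnth ys m) = (l == m)%:R)
    (k : nat) (X : 'I_k -> smodule (twring to))
    (X_inj : forall i j, rm_isomorphic (X i) (X j) -> i = j)
    (X_all : forall M : smodule (twring to), exists i, rm_isomorphic M (X i))
    (x d : 'I_k -> nat)
    (d_gt0 : forall i, (0 < d i)%N)
    (dE : forall i, (d i ^ 2 = \dim_('Z({:endo (X i)})) {:endo (X i)})%N)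
    (e : forall i, 'I_(x i) -> X i)
    (e_basis : forall i, endo_basis (e i))
    (om : forall i, twring to -> 'M[endo (X i)]_(x i))
    (omE : forall i, matrix_operation (e i) (om i))
    (trd : forall i, endo (X i) -> center (endo (X i)))
    (trdE : forall i, reduced_trace (trd i))
    (i i' : 'I_k) (a b : 'I_(x i)) (a' b' : 'I_(x i')) :
  let delta := [&& i == i', a == a' :> nat & b == b' :> nat] in
  ((#|N|%:R / ((x i * d i) %/ \dim {:L})%:R) *+ delta)%:A =
    \sum_(l < \dim {:L}) \sum_(s : gT)
      alg_trace (trd i' (om i' (tw to 1%g (tnth ys l) * tw to s^-1%g 1) b' a'))
        *: om i (tw to s (tnth y l)) a b.
Proof.
move=> delta.
have N_neq0 : #|N|%:R != 0 :> K by rewrite -unitfE.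
have y_ys := trace_basis_expand y_basis ys_dual.
have ys_y := trace_dual_expand y_basis ys_dual.
rewrite [RHS](pair_bigA _ (fun l s =>
  alg_trace (trd i' (om i' (tw to 1%g (tnth ys l) * tw to s^-1%g 1) b' a'))
    *: om i (tw to s (tnth y l)) a b)) /=.
have D_inv j := @endo_inv _ _ (X j).
(* The size of any splitting agrees with the given d, both having the dimension over the center as
   square. *)
have dP j d' : (d' ^ 2 = \dim_('Z({:endo (X j)})) {:endo (X j)})%N -> d' = d j.
  by rewrite -dE => dd; apply/eqP; rewrite -eqn_sqr dd.
rewrite /delta; have [ii'|neq_ii'] := eqVneq i i'; last first.
  have [d' [F [phi [rho [[dimE rho_center _] tE]]]]] := trdE i'.
  have d'_gt0 : (0 < d')%N by rewrite (dP _ _ dimE).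
  rewrite mulr0n scale0r; apply/esym.
  apply: (schur_orthogonal y_ys ys_y (tau := fun z => alg_trace (trd i' z))
    a b a' b' _ (e_basis i) (e_basis i')
    (omE i) (omE i')) => [c u v|iso].
    rewrite /= (trdD (D_inv _) d'_gt0 rho_center tE).
    rewrite (trdZ (D_inv _) d'_gt0 rho_center tE).
    exact: alg_trace_linear.
  by rewrite (X_inj _ _ iso) eqxx in neq_ii'.
case: _ / ii' a' b' {delta} => a' b' /=.
have [d' [F [phi [rho [rhoP tE]]]]] := trdE i.
have [dimE _ _] := rhoP; have dd := dP _ _ dimE.
have d'_gt0 : (0 < d')%N by rewrite dd.
rewrite -dd; apply/esym.
exact: (schur_diagonal kerN N_neq0 ys_dual y_ys ys_y (e_basis i) (omE i)
  d'_gt0 rhoP tE a b a' b').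
Qed.
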